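(* Let $A_{\mathrm d}\in\mathbb{R}^{n\times n}$ be such that $A_{\mathrm d}-I_n$ is nilpotent with nilpotency index $q_{\mathrm d}\le n$ ($(A_{\mathrm d}-I_n)^{q_{\mathrm d}}=0$, $(A_{\mathrm d}-I_n)^{q_{\mathrm d}-1}\ne0$), let $B_{\mathrm d0}\in\mathbb{R}^{n\times m}$ be such that $(A_{\mathrm d},B_{\mathrm d0})$ is controllable, let $D_M$ be a nonnegative integer, $d_0\in\{0,\dots,D_M\}$ an unknown constant integer delay, and let $h$ be a positive integer with $h\ge\max\{D_M,n\}$. Let $B_{\mathrm d}=B_{\mathrm d0}+\Delta B_{\mathrm d}$ with $\Delta B_{\mathrm d}\in\mathbb{R}^{n\times m}$ unknown, $|\Delta B_{\mathrm d}|\le\varepsilon_{\mathrm d}$, $\varepsilon_{\mathrm d}\ge0$ known; let $f_{\mathrm d}$ be an unknown function with $|f_{\mathrm d}(k,x)|\le f_{\mathrm d0}|x|$, $f_{\mathrm d0}\ge0$ known; and let $w_{\mathrm d1},w_{\mathrm d2}$ be locally bounded disturbance sequences. Consider $$x(k+1)=A_{\mathrm d}x(k)+B_{\mathrm d}u(k)+f_{\mathrm d}(k,x(k))+w_{\mathrm d1}(k),\qquad y(k)=x(k-d_0)+w_{\mathrm d2}(k),$$ under the controller $u(k)=-K_{\mathrm d}(k)p(k)y(k-h)$, $k\ge0$. With $\rho_{\mathrm d}(l)=\rho_{\mathrm d0}(l)+\rho_{\mathrm d1}f_{\mathrm d0}$ and $\delta_{\mathrm d}$ defined in the context, assume that $\rho_{\mathrm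 d}(l)<1$ for all values $d_0\in\{0,\dots,D_M\}$ of the delay and all integers $l\ge q_{\mathrm d}$. Then the solution of the closed-loop system satisfies, for all integers $k\ge3(q_{\mathrm d}+1)h$, $$|x(k)|\le|x|_{[0,3(q_{\mathrm d}+1)h]}\,e^{\frac{\ln(\rho_{\mathrm d}(q_{\mathrm d}))}{3(q_{\mathrm d}+1)h}(k-3(q_{\mathrm d}+1)h)}+\frac{\delta_{\mathrm d}\bigl(|w_{\mathrm d1}|_{[0,k]}+|w_{\mathrm d2}|_{[0,k]}\bigr)}{(1-\rho_{\mathrm d}(q_{\mathrm d}))^2},$$ and this is an almost fixed-time ISS estimate: the time step $3(q_{\mathrm d}+1)h$ after which it applies does not depend on the initial condition, and (for fixed $A_{\mathrm d},B_{\mathrm d0},h,D_M$) its exponential convergence rate $-\ln(\rho_{\mathrm d}(q_{\mathrm d}))/(3(q_{\mathrm d}+1)h)$ tends to infinity as $\varepsilon_{\mathrm d}\to0$ and $f_{\mathrm d0}\to0$. In particular, if $\Delta B_{\mathrm d}=0$ and $f_{\mathrm d0}=0$, then $$|x(k)|\le\delta_{\mathrm d}\bigl(|w_{\mathrm d1}|_{[k-3(q_{\mathrm d}+1)h,k]}+|w_{\mathrm d2}|_{[k-3(q_{\mathrm d}+1)h,k]}\bigr)\quad\text{for all } k\ge3(q_{\mathrm d}+1)h,$$ i.e. the closed-loop system is fixed-time ISS with respect to $(w_{\mathrm d1},w_{\mathrm d2})$.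
   Context: $|\cdot|$ is the Euclidean norm on vectors and the induced matrix norm; for a sequence $\phi$, $|\phi|_{[a,b]}$ is the supremum of $|\phi(k)|$ over integers $k\in[a,b]$. $\mathbb{I}_{[p,q]}=\{p,p+1,\dots,q\}$. Sums whose upper limit is smaller than the lower limit are zero. If $\rho_{\mathrm d}(q_{\mathrm d})=0$ the exponential factor is read as $0$. Switching signal: with $l=\lfloor k/(3h)\rfloor$, $p(k)=0$ for $k\in\mathbb{I}_{[3lh,3lh+2h-1]}$ and $p(k)=1$ for $k\in\mathbb{I}_{[3lh+2h,3lh+3h-1]}$. The matrix $\mathcal W_{\mathrm c}=\sum_{k=0}^{h-1}A_{\mathrm d}^kB_{\mathrm d0}B_{\mathrm d0}^{\mathrm T}(A_{\mathrm d}^{\mathrm T})^k$ is invertible (controllability and $h\ge n$), and $A_{\mathrm d}$ is invertible. Gain: with $l=\lfloor k/(3h)\rfloor$, $$K_{\mathrm d}(k)=B_{\mathrm d0}^{\mathrm T}(A_{\mathrm d}^{3hl+3h-k-1})^{\mathrm T}\mathcal W_{\mathrm c}^{-1}A_{\mathrm d}^{5h+3hl-k}.$$ Constants (they depend on $d_0$ and $\Delta B_{\mathrm d}$). For $j\in\mathbb{I}_{[2h,3h-1]}$, $$\Delta_{\mathrm d}(j)=I_n-\sum_{r=2h}^{j}A_{\mathrm d}^{-r-1}B_{\mathrm d0}B_{\mathrm d0}^{\mathrm T}(A_{\mathrm d}^{3h-r-1})^{\mathrm T}\mathcal W_{\mathrm c}^{-1}A_{\mathrm d}^{4h-d_0},$$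 $$\Theta_{\mathrm d}(j)=-\sum_{r=2h}^{j}A_{\mathrm d}^{j-r}\Delta B_{\mathrm d}B_{\mathrm d0}^{\mathrm T}(A_{\mathrm d}^{3h-r-1})^{\mathrm T}\mathcal W_{\mathrm c}^{-1}A_{\mathrm d}^{4h-d_0},$$ $$F_{\mathrm d}=A_{\mathrm d}^{3h}(I_n-A_{\mathrm d}^{h-d_0})-\sum_{r=2h}^{3h-1}A_{\mathrm d}^{3h-r-1}\Delta B_{\mathrm d}B_{\mathrm d0}^{\mathrm T}(A_{\mathrm d}^{3h-r-1})^{\mathrm T}\mathcal W_{\mathrm c}^{-1}A_{\mathrm d}^{4h-d_0},$$ $$\eta_{\mathrm d}=\max\left\{\sup_{j\in\mathbb{I}_{[0,2h-1]}}|A_{\mathrm d}^{j+1}|,\ \sup_{j\in\mathbb{I}_{[2h,3h-1]}}\left(|A_{\mathrm d}^{j+1}\Delta_{\mathrm d}(j)|+|\Theta_{\mathrm d}(j)|\right)\right\},$$ $$\alpha_{\mathrm d1}=\sup_{k\in\mathbb{I}_{[2h,3h-1]}}\left\{\sum_{i=0}^{k}|A_{\mathrm d}^i|+\sum_{i=2h}^{k}\left|A_{\mathrm d}^{k-i}B_{\mathrm d}B_{\mathrm d0}^{\mathrm T}(A_{\mathrm d}^{3h-i-1})^{\mathrm T}\mathcal W_{\mathrm c}^{-1}A_{\mathrm d}^{5h-i}\right|\sum_{r=0}^{i-d_0-h-1}|A_{\mathrm d}^{i-d_0-h-1-r}|\right\},$$ $$\alpha_{\mathrm d2}=\sup_{k\in\mathbb{I}_{[2h,3h-1]}}\sum_{i=2h}^{k}\left|A_{\mathrm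 d}^{k-i}B_{\mathrm d}B_{\mathrm d0}^{\mathrm T}(A_{\mathrm d}^{3h-i-1})^{\mathrm T}\mathcal W_{\mathrm c}^{-1}A_{\mathrm d}^{5h-i}\right|,$$ $$\rho_{\mathrm d0}(l)=\eta_{\mathrm d}|F_{\mathrm d}^l|,\qquad \rho_{\mathrm d1}=\eta_{\mathrm d}\alpha_{\mathrm d1}\sup_{l\in\mathbb{N}}\left\{\sum_{i=0}^{l-1}|F_{\mathrm d}^i|\right\}+\sum_{i=0}^{3h-1}|A_{\mathrm d}^i|+\alpha_{\mathrm d1},$$ $$\delta_{\mathrm d}=\left(\eta_{\mathrm d}\sup_{l\in\mathbb{N}}\sum_{i=0}^{l-1}|F_{\mathrm d}^i|+1\right)(\alpha_{\mathrm d1}+\alpha_{\mathrm d2})+\sum_{i=0}^{3h-1}|A_{\mathrm d}^i| .$$ Fixed-time ISS (discrete time): a discrete-time delay system $x(k+1)=\mathcal F_{\mathrm d}(k,x_{k,d},v(k))$, where $x_{k,d}(m)=x(k+m)$ for $m\in\mathbb{I}_{[-d,0]}$ and $v$ is a disturbance sequence, is fixed-time input-to-state stable if there are $\varphi\in\mathcal K$ and nonnegative integers $T_1\ge T_2$ such that, for every admissible initial sequence and every $v$, the solution is uniquely determined and satisfies $|x(k)|\le\varphi(|v|_{[k-T_2,k]})$ for all $k\ge T_1$. *)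

(* Defs.v *)
From mathcomp Require Export all_boot all_order all_algebra.
From mathcomp Require Export all_classical all_reals all_analysis.
Export numFieldNormedType.Exports.
Export Order.TTheory GRing.Theory Num.Theory.

Set Implicit Arguments.
Unset Strict Implicit.
Unset Printing Implicit Defensive.

#[export] Set Implicit Arguments.
#[export] Unset Strict Implicit.
#[export] Unset Printing Implicit Defensive.

Global Open Scope classical_set_scope.
Global Open Scope ring_scope.

(* The library norm on matrices is the entrywise maximum, hence the following
   Euclidean and induced norms. *)
Definition enorm (R : realType) (n : nat) (x : 'cV[R]_n) : R :=
  Num.sqrt (\sum_i x i 0 ^+ 2).

Definition mxnorm (R : realType) (n m : nat) (M : 'M[R]_(n, m)) : R :=
  sup [set enorm (M *m x) | x in [set x : 'cV[R]_m | enorm x <= 1]].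

(* |phi|_[a,b]: norms are nonnegative, so 0 is a harmless start value. *)
Definition winnorm (R : realType) (n : nat) (phi : int -> 'cV[R]_n)
    (a b : nat) : R :=
  \big[Num.max/0]_(a <= j < b.+1) enorm (phi j).

(* N^q.-1 != 0 forces q > 0 whenever N^q = 0. *)
Definition nilpotency_index (R : realType) (n : nat) (N : 'M[R]_n) (q : nat) :
  Prop := N ^+ q = 0 /\ N ^+ q.-1 <> 0.

Fixpoint trajectory (R : realType) (n m : nat) (A : 'M[R]_n)
    (B : 'M[R]_(n, m)) (x0 : 'cV[R]_n) (u : nat -> 'cV[R]_m) (k : nat) :
    'cV[R]_n :=
  if k is j.+1 then A *m trajectory A B x0 u j + B *m u j else x0.

Definition controllable (R : realType) (n m : nat) (A : 'M[R]_n)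
    (B : 'M[R]_(n, m)) : Prop :=
  forall x0 x1 : 'cV[R]_n, exists (u : nat -> 'cV[R]_m) (N : nat),
    trajectory A B x0 u N = x1.

Section Controller.
Context (R : realType) (n m : nat).
Context (A : 'M[R]_n) (B0 : 'M[R]_(n, m)) (h : nat).

Definition Wc : 'M[R]_n :=
  \sum_(0 <= k < h) A ^+ k *m B0 *m B0^T *m A^T ^+ k.

Definition switching (k : nat) : R :=
  let l := (k %/ (3 * h))%N in
  if (k < 3 * l * h + 2 * h)%N then 0 else 1.

Definition gain (k : nat) : 'M[R]_(m, n) :=
  let l := (k %/ (3 * h))%N in
  B0^T *m (A ^+ (3 * h * l + 3 * h - k - 1))^T *m invmx Wc
       *m A ^+ (5 * h + 3 * h * l - k).

End Controller.

(* All natural-number subtractions in exponents and sum bounds are exact in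
   the ranges where they are used, provided d0 <= h. *)
Section Constants.
Context (R : realType) (n m : nat).
Context (A : 'M[R]_n) (B0 dB : 'M[R]_(n, m)) (h d0 : nat).

Local Notation B := (B0 + dB).
Local Notation W := (Wc A B0 h).

Definition Delta_d (j : nat) : 'M[R]_n :=
  1%:M - \sum_(2 * h <= r < j.+1)
    invmx A ^+ r.+1 *m B0 *m B0^T *m (A ^+ (3 * h - r - 1))^T
      *m invmx W *m A ^+ (4 * h - d0).

Definition Theta_d (j : nat) : 'M[R]_n :=
  - \sum_(2 * h <= r < j.+1)
    A ^+ (j - r) *m dB *m B0^T *m (A ^+ (3 * h - r - 1))^T
      *m invmx W *m A ^+ (4 * h - d0).

Definition F_d : 'M[R]_n :=
  A ^+ (3 * h) *m (1%:M - A ^+ (h - d0))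
  - \sum_(2 * h <= r < 3 * h)
      A ^+ (3 * h - r - 1) *m dB *m B0^T *m (A ^+ (3 * h - r - 1))^T
        *m invmx W *m A ^+ (4 * h - d0).

Definition eta_d : R :=
  Num.max
    (\big[Num.max/0]_(0 <= j < 2 * h) mxnorm (A ^+ j.+1))
    (\big[Num.max/0]_(2 * h <= j < 3 * h)
        (mxnorm (A ^+ j.+1 *m Delta_d j) + mxnorm (Theta_d j))).

Definition feedback_norm (k i : nat) : R :=
  mxnorm (A ^+ (k - i) *m B *m B0^T *m (A ^+ (3 * h - i - 1))^T
            *m invmx W *m A ^+ (5 * h - i)).

Definition alpha_d1 : R :=
  \big[Num.max/0]_(2 * h <= k < 3 * h)
    (\sum_(0 <= i < k.+1) mxnorm (A ^+ i)
     + \sum_(2 * h <= i < k.+1)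
         feedback_norm k i
         * \sum_(0 <= r < i - d0 - h) mxnorm (A ^+ (i - d0 - h - 1 - r))).

Definition alpha_d2 : R :=
  \big[Num.max/0]_(2 * h <= k < 3 * h)
    \sum_(2 * h <= i < k.+1) feedback_norm k i.

(* The real-valued sup is 0 on unbounded sets.  This does not matter when
   A - 1 is nilpotent (n > 0): then eta_d >= |A| >= 1, so
   eta_d * |F_d ^+ q| < 1 for some q makes these partial sums bounded. *)
Definition supsumF : R :=
  sup (range (fun l : nat => \sum_(0 <= i < l) mxnorm (F_d ^+ i))).

Definition rho_d0 (l : nat) : R := eta_d * mxnorm (F_d ^+ l).

Definition rho_d1 : R :=
  eta_d * alpha_d1 * supsumF
  + \sum_(0 <= i < 3 * h) mxnorm (A ^+ i) + alpha_d1.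

Definition rho_d (f0 : R) (l : nat) : R := rho_d0 l + rho_d1 * f0.

Definition delta_d : R :=
  (eta_d * supsumF + 1) * (alpha_d1 + alpha_d2)
  + \sum_(0 <= i < 3 * h) mxnorm (A ^+ i).

End Constants.

(* e^(ln rho / T * t), read as 0 when rho = 0 (the library has ln 0 = 0). *)
Definition decay (R : realType) (rho : R) (T t : nat) : R :=
  if rho == 0 then 0 else expR (ln rho / T%:R * t%:R).

(* The exponential rate -ln rho / T, infinite when rho = 0. *)
Definition rate (R : realType) (rho : R) (T : nat) : \bar R :=
  if rho == 0 then +oo%E else (- ln rho / T%:R)%:E.

Definition class_K (R : realType) (phi : R -> R) : Prop :=
  [/\ phi 0 = 0,
      {in `[0, +oo[ &, {homo phi : s t / s < t}} &
      {within `[0, +oo[, continuous phi}].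

(* x_{k,d} : the index i stands for the offset -i, i.e. x_{k,d}(-i) = x(k-i). *)
Definition segment (V : Type) (d : nat) (x : int -> V) (k : int) :
  'I_d.+1 -> V := fun i => x (k - (i : nat)%:Z).

(* x(k+1) = F(k, x_{k,d}, v_{k,d}), k >= 0.  The right-hand side may depend on
   past values of the disturbance within the same window: here the measurement
   disturbance enters through the input delay. *)
Definition delay_system (R : realType) (n p d : nat) :=
  nat -> ('I_d.+1 -> 'cV[R]_n) -> ('I_d.+1 -> 'cV[R]_p) -> 'cV[R]_n.

Definition solution (R : realType) (n p d : nat) (F : delay_system R n p d)
    (x0 : 'I_d.+1 -> 'cV[R]_n) (v : int -> 'cV[R]_p) (x : int -> 'cV[R]_n) :
    Prop :=
  (forall i : 'I_d.+1, segment x 0 i = x0 i) /\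
  (forall k : nat, x k.+1 = F k (segment x k) (segment v k)).

Definition fixed_time_ISS (R : realType) (n p d : nat)
    (F : delay_system R n p d) : Prop :=
  exists (phi : R -> R) (T1 T2 : nat),
    [/\ class_K phi, (T2 <= T1)%N &
    forall (x0 : 'I_d.+1 -> 'cV[R]_n) (v : int -> 'cV[R]_p),
      [/\ (exists x, solution F x0 v x),
          (forall x x', solution F x0 v x -> solution F x0 v x' ->
             forall k : int, - d%:Z <= k -> x k = x' k) &
          (forall x, solution F x0 v x -> forall k : nat, (T1 <= k)%N ->
             enorm (x k) <= phi (winnorm v (k - T2) k))]].

(* The closed loop as a delay system with maximal delay h + d0 and disturbance
   v = (w1, w2), stacked in one column; y(k-h) = x(k-h-d0) + w2(k-h). *)
Definition closed_loop (R : realType) (n m : nat) (A : 'M[R]_n)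
    (B0 dB : 'M[R]_(n, m)) (h d0 : nat) (f : nat -> 'cV[R]_n -> 'cV[R]_n) :
    delay_system R n (n + n) (h + d0) :=
  fun k xs vs =>
    let y := xs ord_max + dsubmx (vs (inord h)) in
    let u := - (switching R h k *: (gain A B0 h k *m y)) in
    A *m xs ord0 + (B0 + dB) *m u + f k (xs ord0) + usubmx (vs ord0).

Arguments closed_loop {R n m} A B0 dB h d0 f.

(* Main.v *)
Require Import Defs.
From mathcomp Require Import ring lra zify.

(** During the first two thirds of a cycle [3hl, 3hl + 3h) the input is off, so
    in the last third the delayed measurement is a free motion of the state
    z_l = x(3hl), and the gain inverts the Gramian: up to terms of size
    alpha_d1 |f + w1| + alpha_d2 |w2|, x(3hl + k + 1) = P_k z_l, where
    |P_k| <= eta_d and P_(3h-1) = F_d.  For dB = 0 the matrix F_d is A - 1 times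
    a matrix commuting with it, hence F_d^q = 0, so after q cycles only the
    uncertainties survive.  This gives, for k >= T,
      |x(k)| <= rho |x|_[k-T,k-1] + delta (|w1| + |w2|)_[k-T,k],
    and a discrete Halanay argument turns it into exponential decay. *)

(** * Euclidean and induced norms *)

(** The nonlinearity is treated as forcing, of size at most [f0] times the supremum of |x| over a
    window. Hence x(k) is only controlled by a supremum over the preceding window, not by a
    pointwise recurrence, and this is why a Halanay argument is needed. The window has q + 1 cycles
    because an arbitrary k lies at the end of a possibly partial cycle, which q complete ones must
    precede. For the rate, [F_d] is affine in [dB] and its q-th power vanishes at [dB = 0], so
    |F_d^q| is of order [eps]. The other constants only have to stay bounded near [dB = 0]; even
    [supsumF] does, by comparison with a geometric series as soon as |F_d^q| <= 1/2. *)

Lemma sum_sqr_ge0 (R : realType) (n : nat) (a : 'I_n -> R) :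
  0 <= \sum_i a i ^+ 2.
Proof. by apply: sumr_ge0 => i _; apply: sqr_ge0. Qed.

(** The sum of the squares of [Q a_i - S b_i] equals [Q (P Q - S^2)]; divide by [Q], or note that
    [b] vanishes when [Q = 0]. *)
Lemma cauchy_schwarz_sum (R : realType) (n : nat) (a b : 'I_n -> R) :
  (\sum_i a i * b i) ^+ 2 <= (\sum_i a i ^+ 2) * \sum_i b i ^+ 2.
Proof.
set S := \sum_i a i * b i; set P := \sum_i a i ^+ 2; set Q := \sum_i b i ^+ 2.
have Q0 : 0 <= Q by exact: sum_sqr_ge0.
have key : 0 <= Q * (P * Q - S ^+ 2).
  have -> : Q * (P * Q - S ^+ 2) = \sum_i (Q * a i - S * b i) ^+ 2.
    have -> : \sum_i (Q * a i - S * b i) ^+ 2 =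
              \sum_i (Q ^+ 2 * a i ^+ 2 - 2 * Q * S * (a i * b i) + S ^+ 2 * b i ^+ 2).
      by apply: eq_bigr => i _; ring.
    rewrite big_split /= sumrB -!mulr_sumr -/P -/Q -/S; ring.
  exact: sum_sqr_ge0.
have [Qp|] := ltP 0 Q; first by move: key; rewrite pmulr_rge0 // subr_ge0.
move=> Qle; have Qz : Q = 0 by apply/le_anti; rewrite Qle Q0.
have b0 i : b i = 0.
  apply/eqP; rewrite -sqrf_eq0; apply/eqP.
  by apply: (psumr_eq0P _ Qz) => // j _; apply: sqr_ge0.
by rewrite Qz mulr0 /S big1 ?expr0n //= => i _; rewrite b0 mulr0.
Qed.

Lemma enorm_ge0 (R : realType) (n : nat) (x : 'cV[R]_n) : 0 <= enorm x.
Proof. exact: sqrtr_ge0. Qed.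

Lemma enorm0 (R : realType) (n : nat) : enorm (0 : 'cV[R]_n) = 0.
Proof.
by rewrite /enorm big1 ?sqrtr0 // => i _; rewrite mxE expr0n.
Qed.

Lemma enorm_eq0 (R : realType) (n : nat) (x : 'cV[R]_n) : enorm x = 0 -> x = 0.
Proof.
move=> /eqP; rewrite sqrtr_eq0 => le0; apply/colP => i; rewrite mxE.
apply/eqP; rewrite -sqrf_eq0; apply/eqP.
have z : \sum_i x i 0 ^+ 2 = 0.
  by apply/le_anti; rewrite le0 (@sum_sqr_ge0 _ _ (fun i => x i 0)).
by apply: (psumr_eq0P _ z) => // j _; apply: sqr_ge0.
Qed.

Lemma enormZ (R : realType) (n : nat) (a : R) (x : 'cV[R]_n) :
  enorm (a *: x) = `|a| * enorm x.
Proof.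
rewrite /enorm; under eq_bigr do rewrite mxE exprMn.
by rewrite -mulr_sumr sqrtrM ?sqr_ge0 // sqrtr_sqr.
Qed.

Lemma enormN (R : realType) (n : nat) (x : 'cV[R]_n) : enorm (- x) = enorm x.
Proof. by rewrite -scaleN1r enormZ normrN1 mul1r. Qed.

Lemma enormD (R : realType) (n : nat) (x y : 'cV[R]_n) :
  enorm (x + y) <= enorm x + enorm y.
Proof.
have P0 := @sum_sqr_ge0 _ _ (fun i => x i 0).
have Q0 := @sum_sqr_ge0 _ _ (fun i => y i 0).
have CS := @cauchy_schwarz_sum _ _ (fun i => x i 0) (fun i => y i 0).
rewrite -(@ler_pXn2r _ 2) ?nnegrE ?addr_ge0 ?enorm_ge0 //.
rewrite sqrrD [enorm (x + y)]/enorm sqr_sqrtr; last exact: sum_sqr_ge0.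
rewrite [in leRHS]/enorm !sqr_sqrtr // -sqrtrM //.
under eq_bigr do rewrite mxE sqrrD.
rewrite !big_split /= lerD2r lerD2l.
rewrite -mulr2n lerMn2r /=.
apply: (le_trans (ler_norm _)); rewrite -sqrtr_sqr ler_wsqrtr //.
Qed.

Lemma enormB (R : realType) (n : nat) (x y : 'cV[R]_n) :
  enorm (x - y) <= enorm x + enorm y.
Proof. by rewrite -[enorm y]enormN; apply: enormD. Qed.

Lemma enorm_sum (R : realType) (n : nat) (I : Type) (r : seq I) (P : pred I)
    (F : I -> 'cV[R]_n) :
  enorm (\sum_(i <- r | P i) F i) <= \sum_(i <- r | P i) enorm (F i).
Proof.
elim/big_ind2: _ => // [|x a y b xa yb]; first by rewrite enorm0.
exact: le_trans (enormD _ _) (lerD xa yb).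
Qed.

Lemma enorm_entry (R : realType) (n : nat) (x : 'cV[R]_n) (i : 'I_n) :
  `|x i 0| <= enorm x.
Proof.
rewrite -sqrtr_sqr ler_wsqrtr // (bigD1 i) //= lerDl.
by apply: sumr_ge0 => j _; apply: sqr_ge0.
Qed.

(** A crude bound, which shows that the set in [mxnorm] is bounded above, so that its real [sup] is
    a genuine one. *)
Lemma enorm_mulmx_cols (R : realType) (n m : nat) (M : 'M[R]_(n, m))
    (x : 'cV[R]_m) :
  enorm (M *m x) <= (\sum_j enorm (col j M)) * enorm x.
Proof.
have -> : M *m x = \sum_j x j 0 *: col j M.
  apply/colP => i; rewrite mxE summxE; apply: eq_bigr => j _.
  by rewrite !mxE mulrC.
apply: le_trans (enorm_sum _ _ _) _; rewrite mulr_suml.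
apply: ler_sum => j _; rewrite enormZ mulrC.
by apply: ler_wpM2l; [exact: enorm_ge0 | exact: enorm_entry].
Qed.

Lemma mxnorm_unit_ball (R : realType) (n m : nat) (M : 'M[R]_(n, m))
    (x : 'cV[R]_m) :
  enorm x <= 1 -> enorm (M *m x) <= mxnorm M.
Proof.
move=> x1; apply: ub_le_sup; last by exists x.
exists (\sum_j enorm (col j M)) => _ [z /= z1 <-].
apply: le_trans (enorm_mulmx_cols _ _) _.
by rewrite ler_piMr // sumr_ge0 // => j _; apply: enorm_ge0.
Qed.

Lemma mxnorm_ge0 (R : realType) (n m : nat) (M : 'M[R]_(n, m)) : 0 <= mxnorm M.
Proof.
apply: le_trans (enorm_ge0 (M *m 0)) (mxnorm_unit_ball _ _).
by rewrite enorm0.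
Qed.

Lemma enorm_mulmx (R : realType) (n m : nat) (M : 'M[R]_(n, m)) (x : 'cV[R]_m) :
  enorm (M *m x) <= mxnorm M * enorm x.
Proof.
have [x0|x0] := eqVneq (enorm x) 0.
  by rewrite (enorm_eq0 x0) mulmx0 !enorm0 mulr0.
have xp : 0 < enorm x by rewrite lt_def x0 enorm_ge0.
rewrite -ler_pdivrMr // mulrC -[X in X * _]ger0_norm ?invr_ge0 ?enorm_ge0 //.
rewrite -enormZ scalemxAr; apply: mxnorm_unit_ball.
by rewrite enormZ ger0_norm ?invr_ge0 ?enorm_ge0 // mulVf.
Qed.

Lemma mxnorm_le (R : realType) (n m : nat) (M : 'M[R]_(n, m)) (c : R) :
  0 <= c -> (forall x, enorm (M *m x) <= c * enorm x) -> mxnorm M <= c.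
Proof.
move=> c0 Mc; apply: ge_sup.
  by exists (enorm (M *m 0)); exists 0 => //=; rewrite enorm0.
by move=> _ [x /= x1 <-]; apply: le_trans (Mc x) _; rewrite ler_piMr.
Qed.

Lemma mxnorm0 (R : realType) (n m : nat) : mxnorm (0 : 'M[R]_(n, m)) = 0.
Proof.
apply/le_anti; rewrite mxnorm_ge0 andbT; apply: mxnorm_le => // x.
by rewrite mul0mx enorm0 mul0r.
Qed.

Lemma mxnormD (R : realType) (n m : nat) (M N : 'M[R]_(n, m)) :
  mxnorm (M + N) <= mxnorm M + mxnorm N.
Proof.
apply: mxnorm_le => [|x]; first by rewrite addr_ge0 ?mxnorm_ge0.
rewrite mulmxDl mulrDl; apply: le_trans (enormD _ _) _.
by apply: lerD; apply: enorm_mulmx.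
Qed.

Lemma mxnormN (R : realType) (n m : nat) (M : 'M[R]_(n, m)) :
  mxnorm (- M) = mxnorm M.
Proof.
have le (N : 'M[R]_(n, m)) : mxnorm (- N) <= mxnorm N.
  by apply: mxnorm_le => [|x]; rewrite ?mxnorm_ge0 // mulNmx enormN enorm_mulmx.
by apply/le_anti; rewrite le -{1}[M]opprK le.
Qed.

Lemma mxnormM (R : realType) (n m p : nat) (M : 'M[R]_(n, m)) (N : 'M[R]_(m, p)) :
  mxnorm (M *m N) <= mxnorm M * mxnorm N.
Proof.
apply: mxnorm_le => [|x]; first by rewrite mulr_ge0 ?mxnorm_ge0.
rewrite -mulmxA -mulrA; apply: le_trans (enorm_mulmx _ _) _.
by apply: ler_wpM2l; [exact: mxnorm_ge0 | exact: enorm_mulmx].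
Qed.

Lemma mxnorm_sum (R : realType) (n m : nat) (I : Type) (r : seq I) (P : pred I)
    (F : I -> 'M[R]_(n, m)) :
  mxnorm (\sum_(i <- r | P i) F i) <= \sum_(i <- r | P i) mxnorm (F i).
Proof.
elim/big_ind2: _ => // [|x a y b xa yb]; first by rewrite mxnorm0.
exact: le_trans (mxnormD _ _) (lerD xa yb).
Qed.

Lemma mxnorm_exprS (R : realType) (n : nat) (M : 'M[R]_n) (k : nat) :
  mxnorm (M ^+ k.+1) <= mxnorm M * mxnorm (M ^+ k).
Proof. by rewrite exprS; apply: mxnormM. Qed.

Lemma enorm_mulmx_le (R : realType) (n m : nat) (M : 'M[R]_(n, m))
    (x : 'cV[R]_m) (c : R) :
  enorm x <= c -> enorm (M *m x) <= mxnorm M * c.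
Proof.
move=> xc; apply: le_trans (enorm_mulmx _ _) _.
by apply: ler_wpM2l => //; apply: mxnorm_ge0.
Qed.

(** * Suprema over finite windows *)

Lemma le_bigmax_window (R : realType) (a b j : nat) (F : nat -> R) :
  (a <= j < b)%N -> F j <= \big[Num.max/0]_(a <= i < b) F i.
Proof.
by move=> ajb; apply: le_bigmax_seq; rewrite ?mem_index_iota.
Qed.

Lemma bigmax_window_ge0 (R : realType) (a b : nat) (F : nat -> R) :
  0 <= \big[Num.max/0]_(a <= i < b) F i.
Proof. exact: bigmax_ge_id. Qed.

Lemma bigmax_window_le (R : realType) (a b : nat) (F : nat -> R) (c : R) :
  0 <= c -> (forall i, (a <= i < b)%N -> F i <= c) ->
  \big[Num.max/0]_(a <= i < b) F i <= c.
Proof.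
move=> c0 Fc; rewrite big_nat_cond; apply: bigmax_le => // i.
by rewrite andbT; apply: Fc.
Qed.

Lemma le_winnorm (R : realType) (n : nat) (phi : int -> 'cV[R]_n) (a b j : nat) :
  (a <= j <= b)%N -> enorm (phi j) <= winnorm phi a b.
Proof.
move=> ajb; apply: (@le_bigmax_window _ _ _ _ (fun j : nat => enorm (phi j))).
by rewrite ltnS.
Qed.

Lemma winnorm_ge0 (R : realType) (n : nat) (phi : int -> 'cV[R]_n) (a b : nat) :
  0 <= winnorm phi a b.
Proof. exact: bigmax_window_ge0. Qed.

Lemma winnorm_le (R : realType) (n : nat) (phi : int -> 'cV[R]_n) (a b : nat)
    (c : R) :
  0 <= c -> (forall j : nat, (a <= j <= b)%N -> enorm (phi j) <= c) ->
  winnorm phi a b <= c.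
Proof. by move=> c0 pc; apply: bigmax_window_le => // j /pc. Qed.

Lemma winnorm_sub (R : realType) (n : nat) (phi : int -> 'cV[R]_n)
    (a b a' b' : nat) :
  (a' <= a)%N -> (b <= b')%N -> winnorm phi a b <= winnorm phi a' b'.
Proof. by move=> aa bb; apply: le_bigmax_nat. Qed.

(** * Unipotent dynamics and the controllability Gramian *)

Lemma mulmx_exprD (R : realType) (n : nat) (A : 'M[R]_n) (i j : nat) :
  A ^+ i *m A ^+ j = A ^+ (i + j).
Proof. by rewrite exprD. Qed.

Lemma nilpotency_index_gt0 (R : realType) (n : nat) (N : 'M[R]_n) (q : nat) :
  nilpotency_index N q -> (0 < q)%N.
Proof. by case: q => [|//] [N0 N1]; case: N1. Qed.

Lemma nilpotency_index_expr_eq0 (R : realType) (n : nat) (N : 'M[R]_n) (q k : nat) :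
  nilpotency_index N q -> (q <= k)%N -> N ^+ k = 0.
Proof. by move=> [Nq _] qk; rewrite -(subnK qk) exprD Nq mulr0. Qed.

(** Geometric series: for [M = 1 - A], [M^q = 0] gives [(1 - M) (1 + M + ... + M^(q-1)) = 1], and
    [1 - M = A]. *)
Lemma unipotent_unitmx (R : realType) (n : nat) (A : 'M[R]_n) (q : nat) :
  nilpotency_index (A - 1%:M) q -> A \in unitmx.
Proof.
move=> nilA; have q0 := nilpotency_index_gt0 nilA.
have := subrX1 (- (A - 1%:M)) q.
rewrite exprNn (nilpotency_index_expr_eq0 nilA (leqnn q)) mulr0 sub0r opprB.
rewrite [1%:M - A - 1](_ : _ = - A); last by rewrite addrAC subrr sub0r.
rewrite mulNr => /oppr_inj /esym AS.
by have [] := mulmx1_unit AS.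
Qed.

(** A nonzero column of [(A - 1)^(q-1)] is killed by [A - 1], hence fixed by [A]. *)
Lemma mxnorm_unipotent_ge1 (R : realType) (n : nat) (A : 'M[R]_n) (q : nat) :
  nilpotency_index (A - 1%:M) q -> 1 <= mxnorm A.
Proof.
move=> nilA; have q0 := nilpotency_index_gt0 nilA.
have [Nq /eqP/matrix0Pn [i [j Nij]]] := nilA.
set v := col j ((A - 1%:M) ^+ q.-1).
have v0 : v != 0 by apply/cV0Pn; exists i; rewrite mxE.
have vn0 : 0 < enorm v.
  by rewrite lt_def enorm_ge0 andbT; apply: contraNneq v0 => /enorm_eq0 ->.
have Av : A *m v = v.
  apply/eqP; rewrite -subr_eq0 -{2}(mul1mx v) -mulmxBl; apply/eqP.
  rewrite /v colE mulmxA -[X in X *m _]/((A - 1%:M) * (A - 1%:M) ^+ q.-1).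
  by rewrite -exprS prednK // Nq mul0mx.
by have := enorm_mulmx A v; rewrite Av ler_pMl.
Qed.

Lemma trmx_expr (R : realType) (n : nat) (A : 'M[R]_n) (k : nat) :
  (A ^+ k)^T = A^T ^+ k.
Proof.
elim: k => [|k IH]; first by rewrite !expr0 trmx1.
by rewrite exprS exprSr -IH -!mulmxE trmx_mul.
Qed.

(** States reachable from 0 are combinations of columns of the [A^k B]. The free power [A^k] in the
    conclusion makes the induction on time go through. *)
Lemma mulmx_trajectory0 (R : realType) (n m : nat) (A : 'M[R]_n)
    (B : 'M[R]_(n, m)) (v : 'rV[R]_n) (u : nat -> 'cV[R]_m) :
  (forall k, v *m A ^+ k *m B = 0) ->
  forall j k, v *m A ^+ k *m trajectory A B 0 u j = 0.
Proof.
move=> vAB; elim=> [|j IH] k /=; first by rewrite mulmx0.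
rewrite mulmxDr [X in _ + X]mulmxA vAB mul0mx addr0 mulmxA -(mulmxA v).
by rewrite -{2}(expr1 A) mulmx_exprD IH.
Qed.

(* Every power of A = 1 + N is a combination of N^0, ..., N^(q-1), hence of
   A^0, ..., A^(q-1). *)
Lemma unipotent_annihilator (R : realType) (n m : nat) (A : 'M[R]_n)
    (B : 'M[R]_(n, m)) (q : nat) (v : 'rV[R]_n) :
  nilpotency_index (A - 1%:M) q ->
  (forall k, (k < q)%N -> v *m A ^+ k *m B = 0) ->
  forall k, v *m A ^+ k *m B = 0.
Proof.
move=> nilA vAB k.
have vN i : v *m (A - 1%:M) ^+ i *m B = 0.
  have [qi|iq] := leqP q i.
    by rewrite (nilpotency_index_expr_eq0 nilA qi) mulmx0 mul0mx.
  rewrite exprBn_comm; last exact: commr1.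
  rewrite mulmx_sumr mulmx_suml big1 // => j _.
  rewrite expr1n mulr1.
  have -> (X : 'M[R]_n) : (-1) ^+ j * X = (-1 : R) ^+ j *: X.
    by rewrite -(signr_odd _ j) mulr_sign -(signr_odd _ j) scaler_sign.
  rewrite -scaler_nat -!scalemxAr -!scalemxAl.
  by rewrite vAB ?scaler0 // (leq_ltn_trans (leq_subr _ _)).
have -> : A = (A - 1%:M) + 1 by rewrite subrK.
rewrite exprDn_comm; last exact: commr1.
rewrite mulmx_sumr mulmx_suml big1 // => j _.
by rewrite expr1n mulr1 -scaler_nat -scalemxAr -scalemxAl vN scaler0.
Qed.

(** If [v Wc = 0], then [v Wc v^T], a sum of the squares |v A^k B0|^2, vanishes, so [v] annihilates
    [A^k B0] for k < h. As q <= h, this extends to all k, hence to all states reachable from 0.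
    Controllability reaches [v^T], so [v v^T = 0]. *)
Lemma Wc_unitmx (R : realType) (n m q h : nat) (A : 'M[R]_n)
    (B0 : 'M[R]_(n, m)) :
  nilpotency_index (A - 1%:M) q -> (q <= h)%N -> controllable A B0 ->
  Wc A B0 h \in unitmx.
Proof.
move=> nilA qh ctrl; rewrite unitmxE unitfE; apply/negP => /det0P [v v0 vW].
have vAB k : (k < h)%N -> v *m A ^+ k *m B0 = 0.
  move=> kh; have : v *m Wc A B0 h *m v^T = 0 by rewrite vW mul0mx.
  have term j : v *m (A ^+ j *m B0 *m B0^T *m A^T ^+ j) *m v^T
      = (enorm (v *m A ^+ j *m B0)^T ^+ 2)%:M.
    set y := v *m A ^+ j *m B0.
    have -> : v *m (A ^+ j *m B0 *m B0^T *m A^T ^+ j) *m v^T = y *m y^T.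
      by rewrite /y !trmx_mul -trmx_expr !mulmxA.
    rewrite [LHS]mx11_scalar; congr (_%:M).
    rewrite /enorm sqr_sqrtr ?sum_sqr_ge0 // mxE; apply: eq_bigr => i _.
    by rewrite !mxE expr2.
  rewrite /Wc mulmx_sumr mulmx_suml.
  under eq_bigr do rewrite term.
  rewrite -raddf_sum /= => /(congr1 (fun M : 'M[R]_1 => M 0 0)).
  rewrite !mxE eqxx mulr1n big_mkord => /psumr_eq0P zero.
  have /eqP := zero (fun i _ => sqr_ge0 _) (Ordinal kh) isT.
  rewrite sqrf_eq0 => /eqP /enorm_eq0 /(congr1 trmx).
  by rewrite trmxK trmx0.
have vAB' := unipotent_annihilator nilA (fun k kq => vAB k (leq_trans kq qh)).
have [u [N uN]] := ctrl 0 v^T.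
have := mulmx_trajectory0 u vAB' N 0; rewrite uN expr0 mulmx1.
move=> /(congr1 (fun M : 'M[R]_1 => M 0 0)); rewrite !mxE => /psumr_eq0P zero.
case/negP: v0; apply/eqP/rowP => i; rewrite mxE.
have vvT0 j : true -> 0 <= v 0 j * v^T j 0 by rewrite mxE -expr2 sqr_ge0.
by have /eqP := zero vvT0 i isT; rewrite mxE -expr2 sqrf_eq0 => /eqP.
Qed.

Lemma sum_nat_reflect (V : nmodType) (a b : nat) (G : nat -> V) :
  \sum_(a <= i < b) G i = \sum_(0 <= i < b - a) G (b - i - 1)%N.
Proof.
rewrite -{1}(add0n a) big_addn big_nat_rev /= !big_nat.
by apply: eq_bigr => i ?; congr G; lia.
Qed.

(** * Matrices of one cycle and their link with the constants *)

Section ClosedLoopMatrices.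
Context (R : realType) (n m q h d0 : nat).
Context (A : 'M[R]_n) (B0 dB : 'M[R]_(n, m)).
Local Notation B := (B0 + dB).
Local Notation W := (Wc A B0 h).

(* feedback_norm A B0 dB h k i is the norm of this matrix. *)
Definition feedback_mx (k i : nat) : 'M[R]_n :=
  A ^+ (k - i) *m B *m B0^T *m (A ^+ (3 * h - i - 1))^T *m invmx W
    *m A ^+ (5 * h - i).

(** The P_k of a cycle. For 2h <= i < 3h the measurement used at step i shows the state at time i -
    d0 - h < 2h of the cycle, before any input acts; this gives the factor [A ^+ (i - d0 - h)]. *)
Definition transition_mx (k : nat) : 'M[R]_n :=
  A ^+ k.+1 - \sum_(2 * h <= i < k.+1) feedback_mx k i *m A ^+ (i - d0 - h).

Hypothesis dh : (d0 <= h)%N.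

(** Splitting [B] into [B0] and [dB] produces the two terms. In the first,
    [A^(k-i) = A^(k+1) A^(-i-1)] pulls out a common factor; in both, the exponents 5h - i and i - d0
    - h add up to 4h - d0. *)
Lemma transition_mxE (k : nat) :
  A \in unitmx -> (k < 3 * h)%N ->
  transition_mx k = A ^+ k.+1 *m Delta_d A B0 h d0 k + Theta_d A B0 dB h d0 k.
Proof.
move=> Au k3; rewrite /transition_mx /Delta_d /Theta_d mulmxBr mulmx1 -addrA.
congr (_ + _); rewrite mulmx_sumr -opprD -big_split /=; congr (- _).
rewrite !big_nat; apply: eq_bigr => i /andP[i2 ik].
have -> : A ^+ (4 * h - d0) = A ^+ (5 * h - i) *m A ^+ (i - d0 - h).
  by rewrite mulmx_exprD; congr (_ ^+ _); lia.
rewrite /feedback_mx !mulmxA.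
have -> : A ^+ k.+1 *m invmx A ^+ i.+1 = A ^+ (k - i).
  have -> : k.+1 = (k - i + i.+1)%N by lia.
  rewrite -mulmx_exprD -mulmxA -[X in _ *m X]/(A ^+ i.+1 * invmx A ^+ i.+1).
  rewrite -exprMn_comm; last by rewrite /GRing.comm -!mulmxE mulmxV // mulVmx.
  by rewrite -mulmxE mulmxV // expr1n mulmx1.
by rewrite mulmxDr !mulmxDl.
Qed.

(** At the end of the cycle the [B0] part of the feedback sum, read backwards, is the Gramian; it
    cancels [invmx Wc] and leaves [A^(4h-d0) = A^(3h) A^(h-d0)]. *)
Lemma transition_mx_last :
  (0 < h)%N -> W \in unitmx -> transition_mx (3 * h).-1 = F_d A B0 dB h d0.
Proof.
move=> h0 Wu; rewrite /transition_mx /F_d.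
rewrite prednK ?muln_gt0 // mulmxBr mulmx1 -addrA -opprD; congr (_ - _).
have -> : A ^+ (3 * h) *m A ^+ (h - d0) = W *m invmx W *m A ^+ (4 * h - d0).
  by rewrite mulmxV // mul1mx mulmx_exprD; congr (_ ^+ _); lia.
have WE : W = \sum_(2 * h <= i < 3 * h)
    A ^+ (3 * h - i - 1) *m B0 *m B0^T *m (A ^+ (3 * h - i - 1))^T.
  rewrite sum_nat_reflect (_ : (3 * h - 2 * h)%N = h); last by lia.
  rewrite /Wc !big_nat; apply: eq_bigr => i ih.
  by rewrite -trmx_expr (_ : (3 * h - (3 * h - i - 1) - 1)%N = i) //; lia.
rewrite {1}WE !mulmx_suml -big_split /= !big_nat; apply: eq_bigr => i ih.
rewrite (_ : (4 * h - d0)%N = (5 * h - i) + (i - d0 - h))%N; last by lia.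
rewrite -mulmx_exprD /feedback_mx.
rewrite (_ : ((3 * h).-1 - i)%N = 3 * h - i - 1)%N; last by lia.
by rewrite !mulmxA mulmxDr !mulmxDl.
Qed.

End ClosedLoopMatrices.

Lemma F_d_nominal_nilpotent (R : realType) (n m q h d0 k : nat) (A : 'M[R]_n)
    (B0 : 'M[R]_(n, m)) :
  nilpotency_index (A - 1%:M) q -> (q <= k)%N -> F_d A B0 0 h d0 ^+ k = 0.
Proof.
move=> nilA qk; rewrite /F_d big1 ?subr0; last first.
  by move=> i _; rewrite mulmx0 !mul0mx.
have -> : 1%:M - A ^+ (h - d0)
    = (A - 1%:M) * - \sum_(i < h - d0) A ^+ i.
  by rewrite mulrN -subrX1 opprB.
set S := - \sum_(i < _) _; have cS Y : GRing.comm Y A -> GRing.comm Y S.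
  move=> YA; apply: commrN; rewrite /GRing.comm mulr_sumr mulr_suml.
  by apply: eq_bigr => i _; apply: commrX.
have c1 Y : GRing.comm Y A -> GRing.comm Y (A - 1%:M).
  by move=> YA; apply: commrB => //; apply: commr1.
have cAk : GRing.comm (A ^+ (3 * h)) A by apply/commr_sym/commrX.
rewrite mulmxE exprMn_comm; last by apply: commrM; [apply: c1|apply: cS].
rewrite exprMn_comm; last by apply/cS/commr_sym/c1.
by rewrite (nilpotency_index_expr_eq0 nilA qk) mul0r mulr0.
Qed.

(** * One switching cycle *)

(** Used for the state with matrix [A], and for the sampled states at cycle starts with matrix
    [F_d]. *)
Lemma variation_of_constants (R : realType) (n : nat) (A : 'M[R]_n)
    (X b : nat -> 'cV[R]_n) (s j : nat) :
  (forall k, X k.+1 = A *m X k + b k) ->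
  X (s + j)%N = A ^+ j *m X s + \sum_(0 <= i < j) A ^+ (j - 1 - i) *m b (s + i)%N.
Proof.
move=> dyn; elim: j => [|j IH].
  by rewrite addn0 expr0 mul1mx big_nil addr0.
rewrite addnS dyn IH mulmxDr mulmxA -{1}(expr1 A) mulmx_exprD add1n -addrA.
congr (_ + _); rewrite big_nat_recr //= subSS subn0 subnn expr0 mul1mx.
congr (_ + _); rewrite mulmx_sumr !big_nat; apply: eq_bigr => i /andP[_ ij].
rewrite mulmxA -{1}(expr1 A) mulmx_exprD; congr (_ ^+ _ *m _); lia.
Qed.

Section Cycle.
Context (R : realType) (n m h d0 : nat).
Context (A : 'M[R]_n) (B0 dB : 'M[R]_(n, m)).
Context (X Y g w : nat -> 'cV[R]_n).
Local Notation B := (B0 + dB).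
Hypothesis h0 : (0 < h)%N.
Hypothesis dh : (d0 <= h)%N.
Hypothesis dyn : forall k,
  X k.+1 = A *m X k + B *m (- (switching R h k *: (gain A B0 h k *m Y k))) + g k.
(** Since h + d0 <= 2h and the input is off before time 2h, the relation is imposed only where its
    time arguments are nonnegative. The forcing [g] will be the nonlinearity plus [w1]. *)
Hypothesis meas : forall k, (h + d0 <= k)%N ->
  Y k = X (k - d0 - h)%N + w (k - h)%N.

Lemma cycle_index (l i : nat) :
  (i < 3 * h)%N -> ((3 * h * l + i) %/ (3 * h) = l)%N.
Proof.
by move=> i3; rewrite mulnC divnMDl ?muln_gt0 // divn_small // addn0.
Qed.

Lemma switching_cycle (l i : nat) :
  (i < 3 * h)%N -> switching R h (3 * h * l + i) = (2 * h <= i)%N%:R.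
Proof.
by move=> /cycle_index il; rewrite /switching il mulnAC ltn_add2l ltnNge; case: leqP.
Qed.

Lemma gain_cycle (l i : nat) :
  (i < 3 * h)%N ->
  gain A B0 h (3 * h * l + i) =
  B0^T *m (A ^+ (3 * h - i - 1))^T *m invmx (Wc A B0 h) *m A ^+ (5 * h - i).
Proof.
move=> i3; rewrite /gain cycle_index //.
by congr (_ *m (_ ^+ _)^T *m _ *m _ ^+ _); lia.
Qed.

Lemma cycle_formula (l k : nat) :
  (k < 3 * h)%N ->
  X (3 * h * l + k.+1)%N = A ^+ k.+1 *m X (3 * h * l)%N
    + (\sum_(0 <= i < k.+1) A ^+ (k - i) *m g (3 * h * l + i)%N
       - \sum_(2 * h <= i < k.+1) feedback_mx h A B0 dB k i
           *m (X (3 * h * l + (i - d0 - h))%N + w (3 * h * l + i - h)%N)).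
Proof.
move=> k3.
have dyn' j : X j.+1 = A *m X j
   + (B *m (- (switching R h j *: (gain A B0 h j *m Y j))) + g j).
  by rewrite dyn addrA.
rewrite (variation_of_constants _ _ dyn'); congr (_ + _).
under eq_bigr do rewrite mulmxDr.
rewrite big_split /= addrC subn1 /=; congr (_ + _).
rewrite (@big_nat_widenl _ _ _ (2 * h) 0) // [in RHS]big_mkcond -sumrN.
rewrite !big_nat; apply: eq_bigr => i /andP[_ ik].
rewrite switching_cycle ?gain_cycle; try lia.
case: leqP => i2 /=; last by rewrite scale0r oppr0 !mulmx0 oppr0.
rewrite scale1r !mulmxN meas; last lia.
have -> : (3 * h * l + i - d0 - h = 3 * h * l + (i - d0 - h))%N by lia.
by rewrite /feedback_mx !mulmxA.
Qed.

(** The feedback sum of [cycle_formula] starts at 2h, so it is empty here. All delayed times i - d0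
    - h with i < 3h are covered. *)
Lemma cycle_free (l j : nat) :
  (j <= 2 * h)%N ->
  X (3 * h * l + j)%N = A ^+ j *m X (3 * h * l)%N
    + \sum_(0 <= i < j) A ^+ (j - 1 - i) *m g (3 * h * l + i)%N.
Proof.
case: j => [|k] k2; first by rewrite addn0 expr0 mul1mx big_nil addr0.
rewrite cycle_formula; last lia.
rewrite [X in _ - X]big_geq // subr0; congr (_ + _).
by apply: eq_bigr => i _; rewrite subn1.
Qed.

(** The maximum in [alpha_d1] ranges over k >= 2h only. For smaller k the feedback sum is empty and
    the first sum is part of the one at k = 2h. *)
Lemma alpha_d1_ge (k : nat) : (k < 3 * h)%N ->
  \sum_(0 <= i < k.+1) mxnorm (A ^+ i)
  + \sum_(2 * h <= i < k.+1) feedback_norm A B0 dB h k i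
      * \sum_(0 <= r < i - d0 - h) mxnorm (A ^+ (i - d0 - h - 1 - r))
  <= alpha_d1 A B0 dB h d0.
Proof.
move=> k3; have [k2|k2] := ltnP k (2 * h)%N; last first.
  apply: (@le_bigmax_window _ _ _ _ (fun k => _ + _)).
  by rewrite k2.
apply: le_trans; last first.
  by apply: (@le_bigmax_window _ _ _ (2 * h)%N (fun k => _ + _)); lia.
rewrite [X in _ + X <= _]big_geq // addr0.
rewrite (@big_cat_nat _ _ _ k.+1 0 (2 * h).+1) //=; last lia.
rewrite -addrA lerDl addr_ge0 ?sumr_ge0 // => i _; rewrite ?mxnorm_ge0 //.
by rewrite mulr_ge0 ?sumr_ge0 ?mxnorm_ge0 // => j _; apply: mxnorm_ge0.
Qed.

Lemma alpha_d2_ge (k : nat) : (k < 3 * h)%N ->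
  \sum_(2 * h <= i < k.+1) feedback_norm A B0 dB h k i
  <= alpha_d2 A B0 dB h.
Proof.
move=> k3; have [k2|k2] := ltnP k (2 * h)%N.
  by rewrite big_geq //; apply: bigmax_window_ge0.
apply: (@le_bigmax_window _ _ _ _ (fun k => \sum_(2 * h <= i < k.+1) _)).
by rewrite k2.
Qed.

(** The forcing [g] enters twice, directly and through the delayed state expanded by [cycle_free],
    which together give [alpha_d1]; the measurement error enters once and gives [alpha_d2]. The
    terms in the initial state of the cycle make up [transition_mx]. *)
Lemma cycle_remainder (l k : nat) (gam bet : R) :
  (k < 3 * h)%N -> 0 <= bet ->
  (forall i, (i <= k)%N -> enorm (g (3 * h * l + i)%N) <= gam) ->
  (forall i, (2 * h <= i <= k)%N -> enorm (w (3 * h * l + i - h)%N) <= bet) ->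
  enorm (X (3 * h * l + k.+1)%N - transition_mx h d0 A B0 dB k *m X (3 * h * l)%N)
  <= alpha_d1 A B0 dB h d0 * gam + alpha_d2 A B0 dB h * bet.
Proof.
move=> k3 bet0 gle wle.
have gam0 : 0 <= gam by apply: le_trans (enorm_ge0 _) (gle 0%N _); lia.
have gsum j : (j <= k.+1)%N ->
  enorm (\sum_(0 <= i < j) A ^+ (j - 1 - i) *m g (3 * h * l + i)%N)
    <= (\sum_(0 <= i < j) mxnorm (A ^+ (j - 1 - i))) * gam.
  move=> j3; apply: le_trans (enorm_sum _ _ _) _; rewrite mulr_suml.
  by apply: ler_sum_nat => i ij; apply: enorm_mulmx_le; apply: gle; lia.
have -> : X (3 * h * l + k.+1)%N - transition_mx h d0 A B0 dB k *m X (3 * h * l)%N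
  = \sum_(0 <= i < k.+1) A ^+ (k.+1 - 1 - i) *m g (3 * h * l + i)%N
    - \sum_(2 * h <= i < k.+1) feedback_mx h A B0 dB k i
        *m (\sum_(0 <= r < i - d0 - h)
              A ^+ (i - d0 - h - 1 - r) *m g (3 * h * l + r)%N
            + w (3 * h * l + i - h)%N).
  rewrite cycle_formula // /transition_mx mulmxBl subn1 /=.
  set G := \sum_(0 <= i < k.+1) _.
  rewrite mulmx_suml opprB addrC addrA addrNK addrC [in RHS]addrC.
  rewrite -!addrA [X in _ = X]addrC; congr (_ + _).
  rewrite -[LHS]opprK opprD opprK; congr (- _); rewrite -sumrB !big_nat.
  apply: eq_bigr => i /andP[i2 ik]; rewrite cycle_free; last lia.
  rewrite -(mulmxA (feedback_mx _ _ _ _ _ _)).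
  rewrite -mulmxBr; congr (_ *m _).
  by rewrite addrAC [X in X + _ = _]addrAC subrr add0r.
apply: le_trans (enormB _ _) _.
apply: le_trans (lerD (gsum _ (leqnn _)) (enorm_sum _ _ _)) _.
have fb i : (2 * h <= i < k.+1)%N ->
  enorm (feedback_mx h A B0 dB k i
        *m (\sum_(0 <= r < i - d0 - h)
              A ^+ (i - d0 - h - 1 - r) *m g (3 * h * l + r)%N
            + w (3 * h * l + i - h)%N))
  <= feedback_norm A B0 dB h k i
      * (\sum_(0 <= r < i - d0 - h) mxnorm (A ^+ (i - d0 - h - 1 - r))) * gam
     + feedback_norm A B0 dB h k i * bet.
  move=> i2; rewrite -mulrA -mulrDr; apply: enorm_mulmx_le.
  by apply: le_trans (enormD _ _) (lerD (gsum _ _) (wle _ _)); lia.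
apply: le_trans (lerD (lexx _) (ler_sum_nat fb)) _.
rewrite big_split /= -!mulr_suml addrA -mulrDl.
apply: lerD; apply: ler_wpM2r => //; last exact: alpha_d2_ge.
apply: le_trans (alpha_d1_ge k3); rewrite lerD2r.
rewrite sum_nat_reflect subn0 subn1 /= !big_nat (eq_bigr (fun i => mxnorm (A ^+ i))) //.
by move=> i ik; congr (mxnorm (_ ^+ _)); lia.
Qed.

End Cycle.

(** * Contraction over q + 1 cycles and decay *)

(** The bound [C] solves [C = sum + |F^q| C]: after the first q terms, what remains is at most |F^q|
    times a shorter partial sum, so strong induction applies. *)
Lemma power_sum_le (R : realType) (n q : nat) (F : 'M[R]_n) (l : nat) :
  (0 < q)%N -> mxnorm (F ^+ q) < 1 ->
  \sum_(0 <= i < l) mxnorm (F ^+ i)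
  <= (\sum_(0 <= i < q) mxnorm (F ^+ i)) / (1 - mxnorm (F ^+ q)).
Proof.
move=> q0 Fq; set C := _ / _.
have Fq' : 0 < 1 - mxnorm (F ^+ q) by rewrite subr_gt0.
have s0 a b : 0 <= \sum_(a <= i < b) mxnorm (F ^+ i).
  by apply: sumr_ge0 => i _; apply: mxnorm_ge0.
have CE : \sum_(0 <= i < q) mxnorm (F ^+ i) = C - mxnorm (F ^+ q) * C.
  by rewrite -{1}(mul1r C) -mulrBl /C mulrC divfK // gt_eqF.
have C0 : 0 <= C by rewrite divr_ge0 // ltW.
elim/ltn_ind: l => l IH; have [lq|ql] := leqP l q.
  apply: (@le_trans _ _ (\sum_(0 <= i < q) mxnorm (F ^+ i))).
    by rewrite [leRHS](@big_cat_nat _ _ _ l) //= lerDl.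
  by rewrite CE gerBl mulr_ge0 ?mxnorm_ge0.
rewrite (@big_cat_nat _ _ _ q) //=; last exact: ltnW.
rewrite CE -lerBrDl opprB addrC subrK -{1}(add0n q) big_addn.
apply: le_trans (_ : mxnorm (F ^+ q) * \sum_(0 <= i < l - q) mxnorm (F ^+ i) <= _).
  rewrite mulr_sumr; apply: ler_sum => i _.
  by rewrite addnC exprD; apply: mxnormM.
by apply: ler_wpM2l; [exact: mxnorm_ge0 | apply: IH; lia].
Qed.

Section Contraction.
Context (R : realType) (n m q h d0 : nat).
Context (A : 'M[R]_n) (B0 dB : 'M[R]_(n, m)).
Local Notation F := (F_d A B0 dB h d0).
Local Notation S := (supsumF A B0 dB h d0).
Local Notation eta := (eta_d A B0 dB h d0).
Local Notation a1 := (alpha_d1 A B0 dB h d0).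
Local Notation a2 := (alpha_d2 A B0 dB h).
Hypothesis h0 : (0 < h)%N.
Hypothesis dh : (d0 <= h)%N.

Lemma eta_d_ge0 : 0 <= eta.
Proof. by rewrite /eta_d le_max bigmax_window_ge0. Qed.

Lemma alpha_d1_ge0 : 0 <= a1.
Proof. exact: bigmax_window_ge0. Qed.

Lemma alpha_d2_ge0 : 0 <= a2.
Proof. exact: bigmax_window_ge0. Qed.

Lemma mxnorm_power_sum_ge0 (M : 'M[R]_n) (l : nat) :
  0 <= \sum_(0 <= i < l) mxnorm (M ^+ i).
Proof. by apply: sumr_ge0 => i _; apply: mxnorm_ge0. Qed.

Lemma eta_d_ge1 : nilpotency_index (A - 1%:M) q -> 1 <= eta.
Proof.
move=> nilA; apply: le_trans (mxnorm_unipotent_ge1 nilA) _.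
rewrite /eta_d le_max -{1}(expr1 A).
by rewrite (@le_bigmax_window _ _ _ 0 (fun j => mxnorm (A ^+ j.+1))) //; lia.
Qed.

Lemma mxnorm_transition_le (k : nat) :
  A \in unitmx -> (k < 3 * h)%N -> mxnorm (transition_mx h d0 A B0 dB k) <= eta.
Proof.
move=> Au k3; rewrite /eta_d le_max; have [k2|k2] := ltnP k (2 * h)%N.
  rewrite /transition_mx big_geq // subr0.
  by rewrite (@le_bigmax_window _ _ _ k (fun j => mxnorm (A ^+ j.+1))).
apply/orP; right; rewrite transition_mxE //.
apply: le_trans (mxnormD _ _) _.
by apply: (@le_bigmax_window _ _ _ k (fun j => mxnorm _ + mxnorm _)); rewrite k2.
Qed.

Lemma le_supsumF (l : nat) :
  (0 < q)%N -> mxnorm (F ^+ q) < 1 -> \sum_(0 <= i < l) mxnorm (F ^+ i) <= S.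
Proof.
move=> q0 Fq; apply: ub_le_sup; last by exists l.
eexists => _ [j _ <-]; exact: power_sum_le q0 Fq.
Qed.

Lemma supsumF_le :
  (0 < q)%N -> mxnorm (F ^+ q) < 1 ->
  S <= (\sum_(0 <= i < q) mxnorm (F ^+ i)) / (1 - mxnorm (F ^+ q)).
Proof.
move=> q0 Fq; apply: ge_sup; first by eexists; exists 0%N.
by move=> _ [j _ <-]; apply: power_sum_le.
Qed.

(** If the partial sums are unbounded, [sup] has its default value 0; otherwise it dominates the
    empty sum. *)
Lemma supsumF_ge0 : 0 <= S.
Proof.
rewrite /supsumF; set E := (X in sup X).
have [hs|/sup_out -> //] := pselect (has_sup E).
by apply: ub_le_sup; [case: hs | exists 0%N => //; rewrite big_nil].
Qed.

Context (X Y g w : nat -> 'cV[R]_n).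
Hypothesis dyn : forall k,
  X k.+1 = A *m X k + (B0 + dB) *m (- (switching R h k *: (gain A B0 h k *m Y k)))
           + g k.
Hypothesis meas : forall k, (h + d0 <= k)%N ->
  Y k = X (k - d0 - h)%N + w (k - h)%N.

(** Over q complete cycles [F^q] acts on the first sampled state and the remainders are weighted by
    powers of [F], whose norms sum to at most [S]. The last cycle multiplies by at most [eta] and
    adds one more remainder, whence [eta * S + 1]. *)
Lemma window_estimate (k : nat) (xi gam bet : R) :
  (0 < q)%N -> A \in unitmx -> Wc A B0 h \in unitmx -> mxnorm (F ^+ q) < 1 ->
  (3 * q.+1 * h <= k)%N ->
  (forall i, (k - 3 * q.+1 * h <= i < k)%N -> enorm (X i) <= xi) ->
  (forall i, (k - 3 * q.+1 * h <= i < k)%N -> enorm (g i) <= gam) ->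
  (forall i, (k - 3 * q.+1 * h <= i < k)%N -> enorm (w i) <= bet) ->
  enorm (X k) <= eta * mxnorm (F ^+ q) * xi + (eta * S + 1) * (a1 * gam + a2 * bet).
Proof.
move=> q0 Au Wu Fq Tk Xle gle wle.
set D := a1 * gam + a2 * bet.
(* Dividing k - 1 instead of k puts j + 1 in 1..3h, so all cycle starts used lie strictly before k,
   and the window is just long enough to contain the time 3hl. *)
have [l [j [j3 kE]]] : exists l j, (j < 3 * h)%N /\ k = (3 * h * (l + q) + j.+1)%N.
  exists (k.-1 %/ (3 * h) - q)%N, (k.-1 %% (3 * h))%N.
  rewrite ltn_mod muln_gt0; split => //.
  have ql : (q <= k.-1 %/ (3 * h))%N by rewrite leq_divRL ?muln_gt0 //; nia.
  by rewrite subnK // addnS mulnC -divn_eq prednK //; nia.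
have inw i r : (i <= q)%N -> (3 * h * (l + i) + r < k)%N ->
    (k - 3 * q.+1 * h <= 3 * h * (l + i) + r < k)%N.
  by move=> iq rk; apply/andP; split => //; nia.
have k0 : (0 < k)%N by rewrite kE addnS.
have gam0 : 0 <= gam by apply: le_trans (enorm_ge0 _) (gle k.-1 _); nia.
have bet0 : 0 <= bet by apply: le_trans (enorm_ge0 _) (wle k.-1 _); nia.
have D0 : 0 <= D by rewrite addr_ge0 ?mulr_ge0 ?alpha_d1_ge0 ?alpha_d2_ge0.
have rem i r : (i <= q)%N -> (r < 3 * h)%N -> (3 * h * (l + i) + r < k)%N ->
    enorm (X (3 * h * (l + i) + r.+1)%N
           - transition_mx h d0 A B0 dB r *m X (3 * h * (l + i))%N) <= D.
  move=> iq r3 rk; apply: (@cycle_remainder _ _ _ _ _ _ _ _ X Y g w) => //.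
    by move=> a ar; apply/gle/inw => //; lia.
  move=> a ar; apply: wle.
  rewrite (_ : 3 * h * (l + i) + a - h = 3 * h * (l + i) + (a - h))%N; last lia.
  by apply: inw => //; lia.
pose z i := X (3 * h * i)%N.
have zdyn i : z i.+1 = F *m z i + (z i.+1 - F *m z i) by rewrite addrC subrK.
have step i : (i < q)%N -> enorm (z (l + i).+1 - F *m z (l + i)%N) <= D.
  move=> iq; have := rem i (3 * h).-1.
  rewrite transition_mx_last // prednK ?muln_gt0 //.
  by rewrite /z mulnSr; apply; [exact: ltnW | lia | nia].
have zq : enorm (z (l + q)%N) <= mxnorm (F ^+ q) * xi + S * D.
  rewrite (variation_of_constants _ _ zdyn); apply: le_trans (enormD _ _) _.
  apply: lerD.
    apply: enorm_mulmx_le; rewrite /z; apply: Xle.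
    by have := inw 0 0%N; rewrite !addn0; apply => //; nia.
  apply: le_trans (enorm_sum _ _ _) _.
  apply: le_trans (_ : (\sum_(0 <= i < q) mxnorm (F ^+ i)) * D <= _); last first.
    by apply: ler_wpM2r => //; apply: le_supsumF.
  rewrite [X in _ <= X * D]sum_nat_reflect subn0 mulr_suml.
  apply: ler_sum_nat => i /andP[_ iq].
  rewrite (_ : (q - 1 - i)%N = (q - i - 1)%N); last lia.
  by apply: enorm_mulmx_le; apply: step.
have := rem q j (leqnn q) j3; rewrite -kE => /(_ (eq_leq (esym _))) last.
have -> : X k = transition_mx h d0 A B0 dB j *m z (l + q)%N
    + (X k - transition_mx h d0 A B0 dB j *m z (l + q)%N).
  by rewrite addrC subrK.
apply: le_trans (enormD _ _) _.
apply: le_trans (lerD (enorm_mulmx_le _ zq) (last _)) _; first by rewrite kE addnS.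
have -> : eta * mxnorm (F ^+ q) * xi + (eta * S + 1) * D
    = eta * (mxnorm (F ^+ q) * xi + S * D) + D by ring.
rewrite lerD2r; apply: ler_wpM2r; last exact: mxnorm_transition_le.
by apply: le_trans (enorm_ge0 _) zq.
Qed.

End Contraction.

(** With [rho = e^(cT)] and c < 0, the exponential is largest at the left end k - T of the window,
    and the factor [rho] brings it back to its value at k; [D / (1 - rho)] is the fixed point of
    [E = rho E + D]. The recursion is assumed only up to the horizon [K] because [D] will depend on
    the disturbances up to that time. *)
Lemma halanay (R : realType) (a : nat -> R) (rho M D : R) (T K : nat) :
  (0 < T)%N -> 0 < rho < 1 -> 0 <= M -> 0 <= D ->
  (forall k, (k <= T)%N -> a k <= M) ->
  (forall k xi, (T <= k <= K)%N -> (forall i, (k - T <= i < k)%N -> a i <= xi) ->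
     a k <= rho * xi + D) ->
  (T <= K)%N ->
  a K <= M * expR (ln rho / T%:R * (K - T)%:R) + D / (1 - rho).
Proof.
move=> T0 /andP[rho0 rho1] M0 D0 aM step TK.
have T0' : 0 < T%:R :> R by rewrite ltr0n.
pose c : R := ln rho / T%:R.
have c0 : c < 0 by rewrite pmulr_llt0 ?invr_gt0 // ln_lt0 // rho0.
have cT : c * T%:R = ln rho by rewrite /c divfK // gt_eqF.
have E0 : 0 <= D / (1 - rho) by rewrite divr_ge0 // subr_ge0 ltW.
have DE : D / (1 - rho) = rho * (D / (1 - rho)) + D.
  apply/eqP; rewrite -subr_eq0 opprD addrA -{1}(mul1r (D / _)) -mulrBl.
  by rewrite mulrC divfK ?subrr // gt_eqF // subr_gt0.
suff bound k : (k <= K)%N -> a k <= M * expR (c * (k%:R - T%:R)) + D / (1 - rho).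
  by have := bound K (leqnn K); rewrite -natrB.
(* For k <= T the exponent is nonnegative, so the bound holds trivially there. *)
elim/ltn_ind: k => k IH kK; have [kT|Tk] := leqP k T.
  apply: le_trans (aM _ kT) _; rewrite -[leLHS]addr0 lerD // ler_peMr //.
  by rewrite -[leLHS]expR0 ler_expR nmulr_rge0 // subr_le0 ler_nat.
apply: le_trans (step k (M * expR (c * (k%:R - T%:R - T%:R)) + D / (1 - rho)) _ _) _.
- by rewrite kK andbT ltnW.
- move=> i /andP[kTi ik]; apply: le_trans (IH i ik _) _; first lia.
  rewrite lerD2r; apply: ler_wpM2l => //; rewrite ler_expR.
  apply: ler_wnM2l; first exact: ltW.
  by rewrite lerD2r lerBlDr -natrD ler_nat; lia.
- rewrite {2}DE mulrDr addrA lerD2r lerD2r mulrCA -{1}(lnK rho0) -expRD.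
  by rewrite -{1}cT -mulrDr [T%:R + _]addrC subrK.
Qed.

(** * Estimates along closed-loop trajectories *)

Section Estimates.
Context (R : realType) (n m q h d0 : nat).
Context (A : 'M[R]_n) (B0 dB : 'M[R]_(n, m)) (f0 : R).
Local Notation T := (3 * q.+1 * h)%N.
Local Notation F := (F_d A B0 dB h d0).
Local Notation delta := (delta_d A B0 dB h d0).
Local Notation rho := (rho_d A B0 dB h d0 f0 q).
Hypothesis h0 : (0 < h)%N.
Hypothesis dh : (d0 <= h)%N.
Hypothesis f0_ge0 : 0 <= f0.

Lemma rho_d1_ge0 : 0 <= rho_d1 A B0 dB h d0.
Proof.
by rewrite /rho_d1 !addr_ge0 ?mulr_ge0 ?eta_d_ge0 ?alpha_d1_ge0
  ?mxnorm_power_sum_ge0 ?supsumF_ge0.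
Qed.

Lemma rho_d_ge0 : 0 <= rho.
Proof.
by rewrite /rho_d /rho_d0 addr_ge0 ?mulr_ge0 ?eta_d_ge0 ?mxnorm_ge0 ?rho_d1_ge0.
Qed.

(** As [eta_d >= 1], |F^q| is at most [rho_d0], hence at most [rho]. This bounds the partial sums
    behind [supsumF]. *)
Lemma mxnorm_F_d_expr_lt1 :
  nilpotency_index (A - 1%:M) q -> rho < 1 -> mxnorm (F ^+ q) < 1.
Proof.
move=> nilA; apply: le_lt_trans.
rewrite /rho_d /rho_d0 -[leLHS]addr0; apply: lerD; last by rewrite mulr_ge0 ?rho_d1_ge0.
apply: ler_peMl; [exact: mxnorm_ge0 | exact: eta_d_ge1 nilA].
Qed.

Lemma delta_d_ge0 : 0 <= delta.
Proof.
by rewrite /delta_d !addr_ge0 ?mulr_ge0 ?addr_ge0 ?mulr_ge0 ?eta_d_ge0 ?alpha_d1_ge0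
  ?alpha_d2_ge0 ?mxnorm_power_sum_ge0 ?supsumF_ge0.
Qed.

Hypothesis q0 : (0 < q)%N.
Hypothesis Fq : mxnorm (F ^+ q) < 1.
Hypothesis Au : A \in unitmx.
Hypothesis Wu : Wc A B0 h \in unitmx.
Context (f : nat -> 'cV[R]_n -> 'cV[R]_n).
Hypothesis f_le : forall k x, enorm (f k x) <= f0 * enorm x.
Context (w1 w2 x y : int -> 'cV[R]_n) (u : nat -> 'cV[R]_m).
Hypothesis dyn : forall k : nat,
  x k.+1 = A *m x k + (B0 + dB) *m u k + f k (x k) + w1 k.
Hypothesis meas : forall k : int, y k = x (k - d0%:Z) + w2 k.
Hypothesis ctrl : forall k : nat,
  u k = - (switching R h k *: (gain A B0 h k *m y (k%:Z - h%:Z))).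

Lemma contraction_estimate (k : nat) (xi : R) :
  (T <= k)%N -> (forall i : nat, (k - T <= i < k)%N -> enorm (x i) <= xi) ->
  enorm (x k) <= rho * xi + delta * (winnorm w1 (k - T) k + winnorm w2 (k - T) k).
Proof.
move=> Tk xle.
set W1 := winnorm w1 _ _; set W2 := winnorm w2 _ _.
have xi0 : 0 <= xi by apply: le_trans (enorm_ge0 _) (xle k.-1 _); nia.
have W10 : 0 <= W1 by apply: winnorm_ge0.
have W20 : 0 <= W2 by apply: winnorm_ge0.
have meas' j : (h + d0 <= j)%N ->
    y (j%:Z - h%:Z) = x (j - d0 - h)%N + w2 (j - h)%N.
  by move=> hj; rewrite meas; congr (x _ + w2 _); lia.
have dyn' j : x j.+1 = A *m x j
    + (B0 + dB) *m (- (switching R h j *: (gain A B0 h j *m y (j%:Z - h%:Z))))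
    + (f j (x j) + w1 j) by rewrite dyn ctrl !addrA.
have gle i : (k - T <= i < k)%N -> enorm (f i (x i) + w1 i) <= f0 * xi + W1.
  move=> ik; apply: le_trans (enormD _ _) (lerD _ _).
    by apply: le_trans (f_le _ _) _; apply: ler_wpM2l => //; apply: xle.
  by apply: le_winnorm; case/andP: ik => -> /ltnW ->.
have wle i : (k - T <= i < k)%N -> enorm (w2 i) <= W2.
  by case/andP=> ki /ltnW ik; apply: le_winnorm; rewrite ki.
have := @window_estimate _ _ _ q h d0 A B0 dB h0 dh (fun i => x i)
  (fun j => y (j%:Z - h%:Z)) (fun j => f j (x j) + w1 j) (fun i => w2 i) dyn' meas'
  k xi _ _ q0 Au Wu Fq Tk xle gle wle.
move=> /le_trans; apply.
rewrite /rho_d /rho_d0 /rho_d1 /delta_d.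
set e := eta_d _ _ _ _ _; set S := supsumF _ _ _ _ _; set a1 := alpha_d1 _ _ _ _ _.
set a2 := alpha_d2 _ _ _ _; set s := \sum_(0 <= i < 3 * h) _; set N := mxnorm _.
have s0 : 0 <= s by apply: mxnorm_power_sum_ge0.
have a10 : 0 <= a1 by apply: alpha_d1_ge0.
have a20 : 0 <= a2 by apply: alpha_d2_ge0.
have eS1 : 0 <= e * S + 1 by rewrite addr_ge0 ?mulr_ge0 ?eta_d_ge0 ?supsumF_ge0.
(* The slack is explicit: [rho_d1] and [delta_d] both contain the extra summand [s], and [delta_d]
   pairs each of [a1], [a2] with both disturbances. *)
rewrite -subr_ge0 [X in 0 <= X](_ : _ = s * (f0 * xi)
  + (e * S + 1) * (a1 * W2 + a2 * W1) + s * (W1 + W2)); last by ring.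
by do ![apply: addr_ge0 => // | apply: mulr_ge0 => //].
Qed.

Lemma decay_estimate (k : nat) : rho < 1 -> (T <= k)%N ->
  enorm (x k) <= winnorm x 0 T * decay rho T (k - T)
    + delta * (winnorm w1 0 k + winnorm w2 0 k) / (1 - rho) ^+ 2.
Proof.
move=> rho1 Tk; set W := winnorm w1 0 k + winnorm w2 0 k.
have W0 : 0 <= W by rewrite addr_ge0 ?winnorm_ge0.
have step j xi : (T <= j <= k)%N ->
    (forall i, (j - T <= i < j)%N -> enorm (x i) <= xi) ->
    enorm (x j) <= rho * xi + delta * W.
  move=> /andP[Tj jk] /(contraction_estimate Tj) /le_trans; apply.
  rewrite lerD2l; apply: ler_wpM2l; first exact: delta_d_ge0.
  by apply: lerD; apply: winnorm_sub.
have D0 : 0 <= delta * W by rewrite mulr_ge0 ?delta_d_ge0.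
have rho'0 : 0 < 1 - rho by rewrite subr_gt0.
(* The Halanay bound has 1 - rho in the denominator; as 0 < 1 - rho <= 1, squaring it only enlarges
   the quotient. *)
have Dle : delta * W / (1 - rho) <= delta * W / (1 - rho) ^+ 2.
  apply: ler_wpM2l => //; rewrite lef_pV2 ?posrE ?exprn_gt0 //.
  by rewrite expr2 ger_pMl // gerBl rho_d_ge0.
(* For [rho = 0] a single window already gives the claim, so the logarithm is only taken of a
   positive [rho]. *)
rewrite /decay; case: eqP => [rz|/eqP rnz].
  rewrite mulr0 add0r rz subr0 expr1n divr1.
  have := step k (winnorm x 0 k); rewrite rz mul0r add0r; apply.
    by rewrite Tk leqnn.
  by move=> i /andP[_ ik]; apply: le_winnorm; exact: ltnW.
apply: le_trans (lerD (lexx _) Dle).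
apply: (@halanay _ (fun i => enorm (x i))) => //.
- by rewrite !muln_gt0.
- by rewrite rho1 lt_def rnz rho_d_ge0.
- exact: winnorm_ge0.
- by move=> i iT; apply: le_winnorm.
Qed.

End Estimates.

Lemma rho_d_nominal (R : realType) (n m q h d0 : nat) (A : 'M[R]_n)
    (B0 : 'M[R]_(n, m)) :
  nilpotency_index (A - 1%:M) q -> rho_d A B0 0 h d0 0 q = 0.
Proof.
move=> nilA; rewrite /rho_d /rho_d0 (F_d_nominal_nilpotent _ _ _ nilA) //.
by rewrite mxnorm0 !mulr0 addr0.
Qed.

(** * Small perturbations *)

Section LocalBounds.
Context (R : realType) (n m : nat).
Implicit Types (c : 'M[R]_(n, m) -> R).

(** A substitute for continuity at 0: the factors multiplying |F_d^q| and [f0] in [rho_d] only need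
    to be bounded, and this property passes through sums, maxima and matrix products. *)
Definition bounded_near0 c :=
  exists C : R, forall dB, mxnorm dB <= 1 -> c dB <= C.

Lemma bounded_near0_const (C : R) : bounded_near0 (fun=> C).
Proof. by exists C. Qed.

Lemma bounded_near0D c1 c2 :
  bounded_near0 c1 -> bounded_near0 c2 -> bounded_near0 (fun dB => c1 dB + c2 dB).
Proof.
by move=> [C1 h1] [C2 h2]; exists (C1 + C2) => dB le; apply: lerD; auto.
Qed.

Lemma bounded_near0M c1 c2 : (forall dB, 0 <= c1 dB) -> (forall dB, 0 <= c2 dB) ->
  bounded_near0 c1 -> bounded_near0 c2 -> bounded_near0 (fun dB => c1 dB * c2 dB).
Proof.
by move=> p1 p2 [C1 h1] [C2 h2]; exists (C1 * C2) => dB le; apply: ler_pM; auto.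
Qed.

Lemma bounded_near0_max c1 c2 : bounded_near0 c1 -> bounded_near0 c2 ->
  bounded_near0 (fun dB => Num.max (c1 dB) (c2 dB)).
Proof.
move=> [C1 h1] [C2 h2]; exists (Num.max C1 C2) => dB le.
by rewrite ge_max !le_max h1 // h2 // orbT.
Qed.

Lemma bounded_near0_sum (a b : nat) (c : nat -> 'M[R]_(n, m) -> R) :
  (forall i, bounded_near0 (c i)) ->
  bounded_near0 (fun dB => \sum_(a <= i < b) c i dB).
Proof.
move=> bc; elim: (index_iota a b) => [|i s [C IH]].
  by exists 0 => dB _; rewrite big_nil.
have [Ci ci] := bc i; exists (Ci + C) => dB le.
by rewrite big_cons lerD ?ci ?IH.
Qed.

Lemma bounded_near0_bigmax (a b : nat) (c : nat -> 'M[R]_(n, m) -> R) :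
  (forall i, bounded_near0 (c i)) ->
  bounded_near0 (fun dB => \big[Num.max/0]_(a <= i < b) c i dB).
Proof.
move=> bc; elim: (index_iota a b) => [|i s [C IH]].
  by exists 0 => dB _; rewrite big_nil.
have [Ci ci] := bc i; exists (Num.max Ci C) => dB le.
by rewrite big_cons ge_max !le_max ci // IH // orbT.
Qed.

Lemma bounded_near0_le c1 c2 : (forall dB, c1 dB <= c2 dB) ->
  bounded_near0 c2 -> bounded_near0 c1.
Proof. by move=> le [C bC]; exists C => dB /bC; apply: le_trans. Qed.

Lemma bounded_near0_mxnorm : bounded_near0 (@mxnorm R n m).
Proof. by exists 1. Qed.

Lemma bounded_near0_mulmx (p r s : nat) (G : 'M[R]_(n, m) -> 'M[R]_(p, r))
    (H : 'M[R]_(n, m) -> 'M[R]_(r, s)) :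
  bounded_near0 (fun dB => mxnorm (G dB)) -> bounded_near0 (fun dB => mxnorm (H dB)) ->
  bounded_near0 (fun dB => mxnorm (G dB *m H dB)).
Proof.
move=> bG bH; apply: bounded_near0_le (fun dB => mxnormM _ _) _.
by apply: bounded_near0M => // dB; apply: mxnorm_ge0.
Qed.

Lemma bounded_near0_addmx (p r : nat) (G H : 'M[R]_(n, m) -> 'M[R]_(p, r)) :
  bounded_near0 (fun dB => mxnorm (G dB)) -> bounded_near0 (fun dB => mxnorm (H dB)) ->
  bounded_near0 (fun dB => mxnorm (G dB + H dB)).
Proof.
move=> bG bH; apply: bounded_near0_le (fun dB => mxnormD _ _) _.
exact: bounded_near0D.
Qed.

Lemma bounded_near0_oppmx (p r : nat) (G : 'M[R]_(n, m) -> 'M[R]_(p, r)) :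
  bounded_near0 (fun dB => mxnorm (G dB)) ->
  bounded_near0 (fun dB => mxnorm (- G dB)).
Proof. by apply: bounded_near0_le => dB; rewrite mxnormN. Qed.

Lemma bounded_near0_summx (p r a b : nat)
    (G : nat -> 'M[R]_(n, m) -> 'M[R]_(p, r)) :
  (forall i, bounded_near0 (fun dB => mxnorm (G i dB))) ->
  bounded_near0 (fun dB => mxnorm (\sum_(a <= i < b) G i dB)).
Proof.
move=> bG; apply: bounded_near0_le (fun dB => mxnorm_sum _ _ _) _.
exact: bounded_near0_sum.
Qed.

Lemma bounded_near0_exprmx (p k : nat) (G : 'M[R]_(n, m) -> 'M[R]_p) :
  bounded_near0 (fun dB => mxnorm (G dB)) ->
  bounded_near0 (fun dB => mxnorm (G dB ^+ k)).
Proof.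
move=> bG; elim: k => [|k IH].
  by exists (mxnorm (1 : 'M[R]_p)) => dB _; rewrite expr0.
apply: bounded_near0_le (fun dB => mxnorm_exprS _ _) _.
by apply: bounded_near0M => // dB; apply: mxnorm_ge0.
Qed.

Context (h d0 : nat) (A : 'M[R]_n) (B0 : 'M[R]_(n, m)).

(** Follows the syntax of the expression; the first branch closes whatever does not depend on [dB].
    Products of reals are left over, since they require nonnegative factors. *)
Ltac bounded0 := repeat lazymatch goal with
  | |- bounded_near0 (fun _ => ?C) => exact: (bounded_near0_const C)
  | |- bounded_near0 (fun dB => mxnorm dB) => exact: bounded_near0_mxnorm
  | |- bounded_near0 (fun dB => mxnorm (@?G dB *m @?H dB)) =>
      apply: (@bounded_near0_mulmx _ _ _ G H)
  | |- bounded_near0 (fun dB => mxnorm (@?G dB + @?H dB)) =>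
      apply: (@bounded_near0_addmx _ _ G H)
  | |- bounded_near0 (fun dB => mxnorm (- @?G dB)) =>
      apply: (@bounded_near0_oppmx _ _ G)
  | |- bounded_near0 (fun dB => mxnorm (bigop _ _ _)) =>
      apply: bounded_near0_summx => ?
  | |- bounded_near0 (fun dB => Num.max (@?G dB) (@?H dB)) =>
      apply: (@bounded_near0_max G H)
  | |- bounded_near0 (fun dB => bigop _ _ _) =>
      first [apply: bounded_near0_sum => ? | apply: bounded_near0_bigmax => ?]
  | |- bounded_near0 (fun dB => @?G dB + @?H dB) =>
      apply: (@bounded_near0D G H)
  end.

Lemma F_d_bounded : bounded_near0 (fun dB => mxnorm (F_d A B0 dB h d0)).
Proof. rewrite /F_d; bounded0. Qed.

Lemma eta_d_bounded : bounded_near0 (fun dB => eta_d A B0 dB h d0).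
Proof. rewrite /eta_d /Theta_d; bounded0. Qed.

Lemma alpha_d1_bounded : bounded_near0 (fun dB => alpha_d1 A B0 dB h d0).
Proof.
rewrite /alpha_d1; bounded0.
apply: bounded_near0M; try by move=> dB; rewrite ?mxnorm_ge0 ?sumr_ge0.
- move=> dB; apply: sumr_ge0 => *; exact: mxnorm_ge0.
- rewrite /feedback_norm; bounded0.
- bounded0.
Qed.

End LocalBounds.

Section SmallPerturbation.
Context (R : realType) (n m q h d0 : nat).
Context (A : 'M[R]_n) (B0 : 'M[R]_(n, m)).
Hypothesis nilA : nilpotency_index (A - 1%:M) q.

(** [F_d] is affine in [dB]; [C] collects the norms of the factors on either side of [dB]. *)
Lemma F_d_sub_nominal_le :
  exists2 C : R, 0 <= C &
  forall dB, mxnorm (F_d A B0 dB h d0 - F_d A B0 0 h d0) <= C * mxnorm dB.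
Proof.
pose L (r : nat) := A ^+ (3 * h - r - 1).
pose H (r : nat) := B0^T *m (L r)^T *m invmx (Wc A B0 h) *m A ^+ (4 * h - d0).
exists (\sum_(2 * h <= r < 3 * h) mxnorm (L r) * mxnorm (H r)).
  by apply: sumr_ge0 => r _; rewrite mulr_ge0 ?mxnorm_ge0.
move=> dB; rewrite /F_d [X in _ - (_ - X)]big1; last first.
  by move=> r _; rewrite mulmx0 !mul0mx.
rewrite subr0 addrAC subrr add0r mxnormN mulr_suml.
apply: le_trans (mxnorm_sum _ _ _) _; apply: ler_sum => r _.
have -> : A ^+ (3 * h - r - 1) *m dB *m B0^T *m (A ^+ (3 * h - r - 1))^T
   *m invmx (Wc A B0 h) *m A ^+ (4 * h - d0) = L r *m (dB *m H r).
  by rewrite /H !mulmxA.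
rewrite -mulrA [mxnorm (H r) * _]mulrC.
apply: le_trans (mxnormM _ _) _; apply: ler_wpM2l; first exact: mxnorm_ge0.
exact: mxnormM.
Qed.

(** Telescoping, [F^(k+1) - F0^(k+1) = F (F^k - F0^k) + (F - F0) F0^k], where |dB| <= 1 keeps |F|
    bounded. *)
Lemma F_d_expr_sub_nominal_le (k : nat) :
  exists2 C : R, 0 <= C &
  forall dB, mxnorm dB <= 1 ->
    mxnorm (F_d A B0 dB h d0 ^+ k - F_d A B0 0 h d0 ^+ k) <= C * mxnorm dB.
Proof.
have [C1 C10 FC1] := F_d_sub_nominal_le.
have [C2 FC2] := F_d_bounded h d0 A B0.
have C20 : 0 <= C2.
  by apply: le_trans (mxnorm_ge0 _) (FC2 0 _); rewrite mxnorm0.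
elim: k => [|k [C C0 IH]].
  by exists 0 => // dB _; rewrite !expr0 subrr mxnorm0 mul0r.
exists (C2 * C + C1 * mxnorm (F_d A B0 0 h d0 ^+ k)).
  by rewrite addr_ge0 ?mulr_ge0 ?mxnorm_ge0.
move=> dB le1; set F := F_d A B0 dB h d0; set F0 := F_d A B0 0 h d0.
have -> : F ^+ k.+1 - F0 ^+ k.+1 = F *m (F ^+ k - F0 ^+ k) + (F - F0) *m F0 ^+ k.
  by rewrite !exprS (mulmxBr F) (mulmxBl F) addrA subrK.
rewrite mulrDl; apply: le_trans (mxnormD _ _) (lerD _ _).
  rewrite -mulrA; apply: le_trans (mxnormM _ _) _.
  by apply: ler_pM; rewrite ?mxnorm_ge0 ?FC2 ?IH.
rewrite mulrAC; apply: le_trans (mxnormM _ _) _.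
by apply: ler_wpM2r; [exact: mxnorm_ge0 | exact: FC1].
Qed.

Lemma rho_d_small (tol : R) : 0 < tol ->
  exists2 r : R, 0 < r &
  forall (eps f0 : R) (dB : 'M[R]_(n, m)),
    0 <= eps < r -> 0 <= f0 < r -> mxnorm dB <= eps ->
    0 <= rho_d A B0 dB h d0 f0 q < tol.
Proof.
move=> tol0; have q0 := nilpotency_index_gt0 nilA.
have [C C0 FC] := F_d_expr_sub_nominal_le q.
have [E etaE] := eta_d_bounded h d0 A B0.
have [a a1a] := alpha_d1_bounded h d0 A B0.
have [P FP] : bounded_near0 (fun dB : 'M[R]_(n, m) =>
    \sum_(0 <= i < q) mxnorm (F_d A B0 dB h d0 ^+ i)).
  by apply: bounded_near0_sum => i; apply/bounded_near0_exprmx/F_d_bounded.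
have z1 : mxnorm (0 : 'M[R]_(n, m)) <= 1 by rewrite mxnorm0.
have E0 : 0 <= E := le_trans (eta_d_ge0 _ _ _ _ _) (etaE _ z1).
have a0 : 0 <= a := le_trans (alpha_d1_ge0 _ _ _ _ _) (a1a _ z1).
have P0 : 0 <= P := le_trans (mxnorm_power_sum_ge0 _ _) (FP _ z1).
set s := \sum_(0 <= i < 3 * h) mxnorm (A ^+ i).
have s0 : 0 <= s by apply: mxnorm_power_sum_ge0.
(* [Q] will bound [rho_d1]: once |F_d^q| <= 1/2, [supsumF] is at most [P / 2^-1]. *)
pose Q := E * a * (P / 2^-1) + s + a.
have Q0 : 0 <= Q by rewrite !addr_ge0 ?mulr_ge0 ?invr_ge0.
pose K := E * C + Q + 1; have K0 : 0 < K by rewrite ltr_wpDl ?addr_ge0 ?mulr_ge0.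
have C20 : 0 < 2 * (C + 1) by rewrite mulr_gt0 ?ltr_wpDl.
(* The threshold 1 activates the bounds near 0, the second one gives |F_d^q| <= C eps <= 1/2, and
   below [tol / K] the sum [E C eps + Q f0] is less than [(E C + Q + 1) (tol / K) = tol]. *)
exists (Num.min (Num.min 1 (2 * (C + 1))^-1) (tol / K)).
  by rewrite !lt_min ltr01 invr_gt0 C20 divr_gt0.
move=> eps f0 dB; rewrite !lt_min -!andbA => /and4P[eps0 eps1 epsC epsK].
move=> /and4P[f00 _ _ fK] dBle.
have le1 : mxnorm dB <= 1 by rewrite (le_trans dBle) // ltW.
have Fq : mxnorm (F_d A B0 dB h d0 ^+ q) <= C * eps.
  have := FC dB le1; rewrite (F_d_nominal_nilpotent _ _ _ nilA) // subr0 => /le_trans.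
  by apply; apply: ler_wpM2l.
have Fhalf : mxnorm (F_d A B0 dB h d0 ^+ q) <= 2^-1.
  apply: (le_trans Fq); move: epsC; rewrite invfM => epsC.
  have C1 : 0 < C + 1 by rewrite ltr_wpDl.
  rewrite ltr_pdivlMr // in epsC; nra.
have Fq1 : mxnorm (F_d A B0 dB h d0 ^+ q) < 1 by lra.
rewrite rho_d_ge0 //=.
have S0 : 0 <= supsumF A B0 dB h d0 by apply: supsumF_ge0.
have SP : supsumF A B0 dB h d0 <= P / 2^-1.
  apply: le_trans (supsumF_le q0 Fq1) _.
  apply: ler_pM; rewrite ?mxnorm_power_sum_ge0 ?invr_ge0 ?FP //.
    by rewrite subr_ge0 ltW.
  rewrite lef_pV2 ?posrE; lra.
have rho1Q : rho_d1 A B0 dB h d0 <= Q.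
  rewrite /rho_d1 /Q; apply: lerD; last exact: a1a.
  rewrite lerD2r; apply: ler_pM => //; rewrite ?mulr_ge0 ?eta_d_ge0 ?alpha_d1_ge0 //.
  by apply: ler_pM; rewrite ?eta_d_ge0 ?alpha_d1_ge0 ?etaE ?a1a.
have rho0E : rho_d0 A B0 dB h d0 q <= E * C * eps.
  by rewrite /rho_d0 -mulrA; apply: ler_pM; rewrite ?eta_d_ge0 ?mxnorm_ge0 ?etaE.
have K' : tol / K * K = tol by rewrite divfK // gt_eqF.
rewrite /rho_d -K'; apply: (@le_lt_trans _ _ (E * C * eps + Q * f0)).
  by apply: lerD => //; apply: ler_wpM2r.
have EC0 : 0 <= E * C by rewrite mulr_ge0.
have : E * C * eps <= E * C * (tol / K) by apply: ler_wpM2l => //; apply: ltW.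
have : Q * f0 <= Q * (tol / K) by apply: ler_wpM2l => //; apply: ltW.
have tK : 0 < tol / K by rewrite divr_gt0.
rewrite {4}/K; lra.
Qed.

Lemma rate_large (M : R) (T : nat) : (0 < T)%N ->
  exists2 r : R, 0 < r &
  forall (eps f0 : R) (dB : 'M[R]_(n, m)),
    0 <= eps < r -> 0 <= f0 < r -> mxnorm dB <= eps ->
    (M%:E < rate (rho_d A B0 dB h d0 f0 q) T)%E.
Proof.
(* For [rho > 0], the inequality [M < - ln rho / T] means [rho < e^(-M T)]. *)
move=> T0; have [r r0 rho_r] := rho_d_small (expR_gt0 (- (M * T%:R))).
exists r => // eps f0 dB epsr f0r dBe.
have /andP[rho0 rhoM] := rho_r _ _ _ epsr f0r dBe.
rewrite /rate; case: eqP => [_|/eqP rhoN]; first exact: ltry.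
have rhop : 0 < rho_d A B0 dB h d0 f0 q by rewrite lt_def rhoN.
rewrite lte_fin ltr_pdivlMr ?ltr0n // ltrNr -[ltRHS]expRK.
by rewrite ltr_ln ?posrE ?expR_gt0.
Qed.

End SmallPerturbation.

(** The unknown delay takes finitely many values, so the smallest of their radii serves them all. *)
Lemma uniform_radius (R : realType) (D : nat) (P : nat -> R -> Prop) :
  (forall d r r', r' <= r -> P d r -> P d r') ->
  (forall d, exists2 r, 0 < r & P d r) ->
  exists2 r, 0 < r & forall d, (d <= D)%N -> P d r.
Proof.
move=> anti ex; elim: D => [|D [r r0 Pr]].
  by have [r r0 Pr] := ex 0%N; exists r => // d; rewrite leqn0 => /eqP ->.
have [r' r'0 Pr'] := ex D.+1; exists (Num.min r r').
  by rewrite lt_min r0.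
move=> d; rewrite leq_eqVlt => /predU1P[->|dD].
  by apply: anti Pr'; rewrite ge_min lexx orbT.
by apply: anti (Pr d dD); rewrite ge_min lexx.
Qed.

(** * Solutions of delay systems *)

Section DelaySystems.
Context (R : realType) (n p d : nat) (F : delay_system R n p d).
Context (x0 : 'I_d.+1 -> 'cV[R]_n) (v : int -> 'cV[R]_p).

(** State augmentation: iterating the whole history segment turns the delay recursion into a
    one-step recursion, structural in k. *)
Fixpoint segment_orbit (k : nat) : 'I_d.+1 -> 'cV[R]_n :=
  if k is j.+1 then
    fun i => if val i is i'.+1 then segment_orbit j (inord i')
             else F j (segment_orbit j) (segment v j)
  else x0.

(** [Negz k] is -(k+1), hence the index [k.+1]. Before time -d, [inord] falls back to index 0; no
    segment at a time k >= 0 reaches that far. *)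
Definition orbit_solution (z : int) : 'cV[R]_n :=
  match z with
  | Posz k => segment_orbit k ord0
  | Negz k => x0 (inord k.+1)
  end.

Lemma segment_orbitE (k : nat) (i : 'I_d.+1) :
  segment orbit_solution k i = segment_orbit k i.
Proof.
rewrite /segment; elim: k i => [|k IH] [[|i] id] /=.
- by congr x0; apply: val_inj.
- by congr x0; apply: val_inj; rewrite subn0 /= inordK.
- by rewrite addn0.
- rewrite -IH inordK ?(ltnW id) //; congr orbit_solution; lia.
Qed.

Lemma solution_exists : exists x, solution F x0 v x.
Proof.
exists orbit_solution; split=> [i|k]; first exact: segment_orbitE.
have -> : segment orbit_solution k = segment_orbit k.
  by apply/funext => i; apply: segment_orbitE.
by [].
Qed.

Lemma solution_unique (x x' : int -> 'cV[R]_n) :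
  solution F x0 v x -> solution F x0 v x' ->
  forall k : int, - d%:Z <= k -> x k = x' k.
Proof.
move=> [x_0 xS] [x'_0 x'S].
(* The induction carries whole segments, since the next value depends on all of the last d + 1
   values. *)
have eqseg (k : nat) : segment x k = segment x' k :> ('I_d.+1 -> 'cV[R]_n).
  elim: k => [|k IH]; apply/funext => i; first exact: etrans (x_0 i) (esym (x'_0 i)).
  case: i => [[|i] id]; rewrite /segment /=; first by rewrite subr0 xS x'S IH.
  have := congr1 (fun s => s (inord i)) IH; rewrite /segment inordK ?(ltnW id) //.
  by have -> : k.+1%:Z - i.+1%:Z = k%:Z - i%:Z by lia.
case=> k dk.
  by have := congr1 (fun s => s ord0) (eqseg k); rewrite /segment subr0.
have kd : (k.+1 < d.+1)%N by lia.
have := congr1 (fun s => s (Ordinal kd)) (eqseg 0%N).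
by rewrite /segment /= sub0r -NegzE.
Qed.

End DelaySystems.

(** * The stacked disturbance and the assembly of the estimates *)

Lemma enorm_usubmx (R : realType) (n p : nat) (v : 'cV[R]_(n + p)) :
  enorm (usubmx v) <= enorm v.
Proof.
rewrite ler_wsqrtr // big_split_ord /=.
under eq_bigr do rewrite mxE.
by rewrite lerDl; apply: sumr_ge0 => i _; apply: sqr_ge0.
Qed.

Lemma enorm_dsubmx (R : realType) (n p : nat) (v : 'cV[R]_(n + p)) :
  enorm (dsubmx v) <= enorm v.
Proof.
rewrite ler_wsqrtr // big_split_ord /=.
under eq_bigr do rewrite mxE.
by rewrite lerDr; apply: sumr_ge0 => i _; apply: sqr_ge0.
Qed.

Lemma class_K_scale (R : realType) (c : R) : 0 < c -> class_K (fun s : R => c * s).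
Proof.
move=> c0; split; first by rewrite mulr0.
  by move=> s t _ _ st; rewrite ltr_pM2l.
by apply: continuous_subspaceT => s; apply: cvgMl_tmp; apply: cvg_id.
Qed.

Theorem theorem3 (R : realType) (n m q DM d0 h T : nat)
  (A : 'M[R]_n) (B0 dB : 'M[R]_(n, m)) (eps f0 : R)
  (f : nat -> 'cV[R]_n -> 'cV[R]_n)
  (nilA : nilpotency_index (A - 1%:M) q) (le_q_n : (q <= n)%N)
  (ctrl : controllable A B0)
  (le_d0_DM : (d0 <= DM)%N) (h_gt0 : (0 < h)%N) (le_DM_n_h : (maxn DM n <= h)%N)
  (eps_ge0 : 0 <= eps) (dB_le : mxnorm dB <= eps)
  (f0_ge0 : 0 <= f0) (f_le : forall k x, enorm (f k x) <= f0 * enorm x)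
  (rho_lt1 : forall d l : nat, (d <= DM)%N -> (q <= l)%N ->
     rho_d A B0 dB h d f0 l < 1)
  (T_def : T = (3 * q.+1 * h)%N) :
  [/\ (* estimates along every solution of the closed loop *)
      (forall (w1 w2 x y : int -> 'cV[R]_n) (u : nat -> 'cV[R]_m),
        (forall k : nat,
           x k.+1 = A *m x k + (B0 + dB) *m u k + f k (x k) + w1 k) ->
        (forall k : int, y k = x (k - d0%:Z) + w2 k) ->
        (forall k : nat,
           u k = - (switching R h k *: (gain A B0 h k *m y (k%:Z - h%:Z)))) ->
        (forall k : nat, (T <= k)%N ->
           enorm (x k) <=
             winnorm x 0 T * decay (rho_d A B0 dB h d0 f0 q) T (k - T)
             + delta_d A B0 dB h d0 * (winnorm w1 0 k + winnorm w2 0 k)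
               / (1 - rho_d A B0 dB h d0 f0 q) ^+ 2)
        /\
        (dB = 0 -> f0 = 0 -> forall k : nat, (T <= k)%N ->
           enorm (x k) <=
             delta_d A B0 dB h d0
             * (winnorm w1 (k - T) k + winnorm w2 (k - T) k))),
      (* the convergence rate tends to infinity as eps, f0 -> 0, uniformly in
         the unknown delay and in the unknown perturbation *)
      (forall M : R, exists2 r : R, 0 < r &
        forall (eps' f0' : R) (dB' : 'M[R]_(n, m)) (d : nat),
          0 <= eps' < r -> 0 <= f0' < r -> mxnorm dB' <= eps' ->
          (d <= DM)%N ->
          (M%:E < rate (rho_d A B0 dB' h d f0' q) T)%E) &
      (dB = 0 -> f0 = 0 -> fixed_time_ISS (closed_loop A B0 dB h d0 f))].
Proof.
have q0 := nilpotency_index_gt0 nilA.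
have Au := unipotent_unitmx nilA.
have dh : (d0 <= h)%N by lia.
have Wu : Wc A B0 h \in unitmx by apply: Wc_unitmx nilA _ ctrl; lia.
have rho1 := rho_lt1 d0 q le_d0_DM (leqnn q).
have Fq : mxnorm (F_d A B0 dB h d0 ^+ q) < 1 by apply: mxnorm_F_d_expr_lt1 nilA rho1.
have nominal (w1 w2 x y : int -> 'cV[R]_n) (u : nat -> 'cV[R]_m) :
    (forall k : nat, x k.+1 = A *m x k + (B0 + dB) *m u k + f k (x k) + w1 k) ->
    (forall k : int, y k = x (k - d0%:Z) + w2 k) ->
    (forall k : nat,
      u k = - (switching R h k *: (gain A B0 h k *m y (k%:Z - h%:Z)))) ->
    dB = 0 -> f0 = 0 -> forall k : nat, (T <= k)%N ->
    enorm (x k) <= delta_d A B0 dB h d0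
      * (winnorm w1 (k - T) k + winnorm w2 (k - T) k).
  move=> dyn meas ctl dBz f0z k Tk; subst T.
  have := @contraction_estimate _ _ _ q h d0 A B0 dB f0 h_gt0 dh f0_ge0 q0 Fq Au Wu
    f f_le w1 w2 x y u dyn meas ctl k (winnorm x 0 k) Tk.
  (* The coefficient of [xi] is 0, so any bound on the past serves and the initial state leaves no
     trace. *)
  rewrite {1}dBz {1}f0z rho_d_nominal // mul0r add0r; apply.
  by move=> i /andP[_ ik]; apply: le_winnorm; apply: ltnW.
split.
- move=> w1 w2 x y u dyn meas ctl; split; last exact: nominal dyn meas ctl.
  rewrite T_def => k.
  exact: (@decay_estimate _ _ _ q h d0 A B0 dB f0 h_gt0 dh f0_ge0 q0 Fq Au Wu
            f f_le w1 w2 x y u dyn meas ctl k rho1).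
- move=> M.
  have [|d|r r0 rate_r] := @uniform_radius R DM (fun d r =>
      forall (eps f0 : R) (dB : 'M[R]_(n, m)),
      0 <= eps < r -> 0 <= f0 < r -> mxnorm dB <= eps ->
      (M%:E < rate (rho_d A B0 dB h d f0 q) T)%E).
  + move=> d r r' r'r H e g b /andP[e0 er] /andP[g0 gr].
    by apply: H; rewrite ?e0 ?g0 /= (lt_le_trans _ r'r).
  + by apply: rate_large nilA _ _ _; rewrite T_def !muln_gt0.
  + by exists r => // e g b d er gr be dD; apply: rate_r dD _ _ _ er gr be.
- move=> dBz f0z; set D := delta_d A B0 dB h d0 in nominal.
  have D0 : 0 <= D by apply: delta_d_ge0.
  (* Each of [w1], [w2] is dominated by the stacked [v], which gives 2D; the added 1 keeps the gain
     strictly increasing even if [D = 0]. *)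
  exists (fun s => (2 * D + 1) * s), T, T; split => //.
    by apply: class_K_scale; rewrite ltr_wpDl ?mulr_ge0.
  move=> x0 v; split; [exact: solution_exists | exact: solution_unique |].
  move=> x [_ xS] k Tk.
  pose w1 z := usubmx (v z); pose w2 z := dsubmx (v z).
  pose y z := x (z - d0%:Z) + w2 z.
  pose u (k : nat) := - (switching R h k *: (gain A B0 h k *m y (k%:Z - h%:Z))).
  have dyn (j : nat) : x j.+1 = A *m x j + (B0 + dB) *m u j + f j (x j) + w1 j.
    have xmax : segment x j (ord_max : 'I_(h + d0).+1) = x (j%:Z - h%:Z - d0%:Z).
      by rewrite /segment; congr (x _); rewrite /=; lia.
    have vh : segment v j (inord h : 'I_(h + d0).+1) = v (j%:Z - h%:Z).
      by rewrite /segment inordK ?ltnS ?leq_addr.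
    have seg0 V (z : int -> V) : segment z j (ord0 : 'I_(h + d0).+1) = z j.
      by rewrite /segment subr0.
    by rewrite xS /closed_loop xmax vh !seg0.
  have w1v : winnorm w1 (k - T) k <= winnorm v (k - T) k.
    apply: winnorm_le => [|j jk]; first exact: winnorm_ge0.
    exact: le_trans (enorm_usubmx _) (le_winnorm _ jk).
  have w2v : winnorm w2 (k - T) k <= winnorm v (k - T) k.
    apply: winnorm_le => [|j jk]; first exact: winnorm_ge0.
    exact: le_trans (enorm_dsubmx _) (le_winnorm _ jk).
  apply: le_trans (nominal w1 w2 x y u dyn (fun=> erefl) (fun=> erefl) dBz f0z k Tk) _.
  apply: le_trans (ler_wpM2l D0 (lerD w1v w2v)) _.
  have := winnorm_ge0 v (k - T) k; nra.
Qed.
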